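(* Let $G$ be a metabelian $3$-group with abelianisation $G/\gamma_2(G)$ of type $(3,3)$, of order $|G|=3^n$, class $\mathrm{cl}(G)=m-1$, and of lower than second maximal class, i.e. $e=n-m+2\ge 4$ (and thus with $m\ge 6$, or $m=5$ and $k=0$). Let generators of $G=\langle x,y\rangle$ be selected such that $\gamma_3(G)=\langle y^3,x^3,\gamma_4(G)\rangle$, $x\in G\setminus\chi_s(G)$ if $s<m-1$, and $y\in\chi_s(G)\setminus\gamma_2(G)$. Let the maximal normal subgroups be ordered by $M_i=\langle g_i,\gamma_2(G)\rangle$ with $g_1=y$, $g_2=x$, $g_3=xy$, $g_4=xy^{-1}$. Put $s_2=t_2=[y,x]$, $s_j=[s_{j-1},x]$, $t_j=[t_{j-1},y]$ for $j\ge 3$, $\sigma_3=y^3$, $\tau_3=x^3$, and $\sigma_j=[\sigma_{j-1},x]$, $\tau_j=[\tau_{j-1},y]$ for $j\ge 4$. Suppose that $G$ is defined by the relations $$s_2^3=\sigma_4\sigma_{m-1}^{-\rho\beta}\tau_4^{-1},\quad s_3\sigma_3\sigma_4=\sigma_{m-2}^{\rho\beta}\sigma_{m-1}^{\gamma}\tau_e^{\delta},\quad t_3^{-1}\tau_3\tau_4=\sigma_{m-2}^{\rho\delta}\sigma_{m-1}^{\alpha}\tau_e^{\beta},\quad \tau_{e+1}=\sigma_{m-1}^{-\rho}$$ with a system of exponents $-1\le\alpha,\beta,\gamma,\delta,\rho\le 1$, and that $[\chi_s(G),\gamma_e(G)]=\gamma_{m-k}(G)$ with $0\le k\le 1$.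 For $-1\le\lambda,\mu\le 1$ define $$f(\lambda,\mu)=\begin{cases}0,&\text{if }\lambda=0,\ \mu=0,\\ 1,&\text{if }\lambda=\pm1,\ \mu=0,\\ 2,&\text{if }\lambda=0,\ \mu=\pm1,\\ 3,&\text{if }\lambda=\pm1,\ \mu=\pm1,\ \lambda=-\mu,\\ 4,&\text{if }\lambda=\pm1,\ \mu=\pm1,\ \lambda=\mu.\end{cases}$$ Then the singulets of transfer types of $G$ are $$\varkappa(1)=\begin{cases}f(\alpha,\gamma),&\text{if }k=0,\\ f(\delta,\beta),&\text{if }k=1,\end{cases}\qquad \varkappa(2)=f(\beta,\delta),\qquad\varkappa(3)=4,\qquad\varkappa(4)=3.$$ Therefore the kernels of the transfers $\mathrm{V}_i:G/\gamma_2(G)\to M_i/\gamma_2(M_i)$, $1\le i\le 4$, are $\mathrm{Ker}(\mathrm{V}_i)=M_{\varkappa(i)}/\gamma_2(G)$ if $1\le\varkappa(i)\le 4$, and $\mathrm{Ker}(\mathrm{V}_i)=G/\gamma_2(G)$ if $\varkappa(i)=0$.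
   Context: Conventions: $[a,b]=a^{-1}b^{-1}ab$, $a^b=b^{-1}ab$. The lower central series is $\gamma_1(G)=G$, $\gamma_j(G)=[\gamma_{j-1}(G),G]$ for $j\ge 2$. Metabelian means that $\gamma_2(G)$ is abelian. The coclass is $\mathrm{cc}(G)=n-\mathrm{cl}(G)$; $m=\mathrm{cl}(G)+1$ is the index of nilpotency. The invariant $e=e(G)$ is defined by $e+1=\min\{3\le j\le m\mid 1\le|\gamma_j(G)/\gamma_{j+1}(G)|\le 3\}$; for metabelian $3$-groups of coclass $\ge 2$ with abelianisation of type $(3,3)$ it satisfies $e=n-m+2=\mathrm{cc}(G)+1$, and $4\le m<n\le 2m-3$. For $2\le j\le m-1$, $\chi_j(G)=\{g\in G\mid[g,u]\in\gamma_{j+2}(G)\text{ for all }u\in\gamma_j(G)\}$; one has $\gamma_2(G)\le\chi_2(G)\le\cdots\le\chi_{m-2}(G)<\chi_{m-1}(G)=G$, and $s=s(G)=\min\{2\le j\le m-1\mid\chi_j(G)>\gamma_2(G)\}$. $\mathrm{V}_i$ is the usual group theoretic transfer from $G$ to $M_i$. The singulet of transfer type is $\varkappa(i)=0$ if $\mathrm{Ker}(\mathrm{V}_i)=G/\gamma_2(G)$, and $\varkappa(i)=j$ if $\mathrm{Ker}(\mathrm{V}_i)=M_j/\gamma_2(G)$ with $1\le j\le 4$. *)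

(* Defs.v *)
From mathcomp Require Import all_boot all_algebra all_fingroup all_solvable.

Set Implicit Arguments.
Unset Strict Implicit.
Unset Printing Implicit Defensive.

Import GRing.Theory FiniteModule.
Local Open Scope group_scope.

Definition expgz (gT : finGroupType) (u : gT) (z : int) : gT :=
  match z with Posz i => u ^+ i | Negz i => u ^- i.+1 end.

Notation "u ^z z" := (expgz u z%R)
  (at level 30, z at level 29, no associativity) : group_scope.

Definition is_least (P : pred nat) (i : nat) : Prop :=
  P i /\ forall j, P j -> i <= j.

Section LowerCentralInvariants.

Variables (gT : finGroupType) (G : {group gT}).

Definition nil_index : nat := (nil_class G).+1.

Definition chi (j : nat) : {set gT} :=
  [set g in G | [forall (u | u \in 'L_j(G)), [~ g, u] \in 'L_j.+2(G)]].

Definition is_inv_e (e : nat) : Prop :=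
  is_least (fun j => [&& 3 <= j, j <= nil_index
                       & 1 <= #|'L_j(G) / 'L_j.+1(G)| <= 3]) e.+1.

Definition is_inv_s (s : nat) : Prop :=
  is_least (fun j => [&& 2 <= j, j <= nil_index.-1
                       & 'L_2(G) \proper chi j]) s.

End LowerCentralInvariants.

Section Transfer.

Variables (gT : finGroupType) (G M : {group gT}).

Definition ab_proj := restrm_morphism (lcn_norm 2 M) (coset_morphism 'L_2(M)).

Lemma ab_proj_abelian : abelian (ab_proj @* M).
Proof. by rewrite morphim_restrm setIid sub_der1_abelian. Qed.

Lemma ker_transfer_sub :
  'ker (coset 'L_2(G)) \subset 'ker (transfer_morphism G ab_proj_abelian).
Proof.
rewrite ker_coset gen_subG; apply/subsetP => _ /imset2P[a b Ga Gb ->].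
apply/kerP; [exact: groupR | rewrite morphR //].
by apply/eqP/commgP; apply: (@addrC (fmod_of ab_proj_abelian)).
Qed.

(* The transfer from G to M / 'L_2(M) (the latter written additively, as in
   the library), factored through G / 'L_2(G). *)
Definition ab_transfer :=
  factm_morphism ker_transfer_sub (lcn_norm 2 G).

Definition ker_transfer : {set coset_of 'L_2(G)} := 'ker ab_transfer.

End Transfer.

Section TransferType.

Variables (gT : finGroupType) (G : {group gT}) (x y : gT).

Definition max_gen (i : nat) : gT :=
  nth 1 [:: y; x; x * y; x * y^-1] i.-1.

Definition max_sub (i : nat) : {group gT} := <<max_gen i |: 'L_2(G)>>%G.

(* 5 is returned for a kernel to which no singulet is assigned. *)
Definition singulet (i : nat) : nat :=
  let K := ker_transfer G (max_sub i) in
  if K == G / 'L_2(G) then 0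
  else (find (fun j => K == max_sub j / 'L_2(G)) (iota 1 4)).+1.

End TransferType.

Section BasicCommutators.

Variables (gT : finGroupType) (x y : gT).

(* The families are meaningful for j >= 2, resp. j >= 3, only. *)
Definition s_ (j : nat) : gT := iter (j - 2) (fun u => [~ u, x]) [~ y, x].
Definition t_ (j : nat) : gT := iter (j - 2) (fun u => [~ u, y]) [~ y, x].
Definition sigma_ (j : nat) : gT := iter (j - 3) (fun u => [~ u, x]) (y ^+ 3).
Definition tau_ (j : nat) : gT := iter (j - 3) (fun u => [~ u, y]) (x ^+ 3).

End BasicCommutators.

Definition transfer_f (lambda mu : int) : nat :=
  if mu == 0%R then (if lambda == 0%R then 0 else 1)%N
  else if lambda == 0%R then 2 else if lambda == (- mu)%R then 3 else 4.

(* Main.v *)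
From HB Require Import structures.
Require Import Defs.
From mathcomp Require Import all_boot all_algebra all_fingroup all_solvable zify.
Set Implicit Arguments.
Unset Strict Implicit.
Unset Printing Implicit Defensive.
Import GRing.Theory FinRing.Theory FiniteModule.
Local Open Scope group_scope.

(* Write A = 'L_2(G) additively as a module with commuting operators X = x - 1
   and Y = y - 1, so that sigma_j = X^(j-3) y^3 and tau_j = Y^(j-3) x^3 with
   Y sigma_j = X tau_j = 0. Every 'L_j(G), j >= 3, is spanned by the sigma_i and
   tau_i with i >= j, and for 3 <= j <= e the layer 'L_j(G) / 'L_j.+1(G) is not
   cyclic. Since M_i / A is cyclic, the commutator subgroup of M_i = <g_i, A> is
   the image of g_i - 1 on A; the transfer to M_i sends g outside M_i to g^3 and
   g in M_i to g g^r g^(r^2). Modulo the image of g_i - 1 the relations turn the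
   values at x and y into multiples of one element w: sigma_(m-1) (k = 0) or
   sigma_(m-2)^rho (k = 1) for M_1, tau_e for M_2, x^3 for M_3 and M_4; the two
   multipliers then determine the kernel. It remains to see that w is not in
   the image of g_i - 1. For M_1 and M_2 this holds because an element of
   Z A (Z = X, Y) that lies in 'L_j(G), j <= e, is in Z^(j-2) A: indeed
   3 Z A <= Z^2 A, as (1 + Z)^3 = 1, and Z^(j-2) A is generated modulo
   Z^(j-1) A by Z^(j-2) [y, x], which is not in 'L_j.+1(G). *)

(** * Generators of the lower central series *)

Lemma gen_set2U_exp (gT : finGroupType) (A H : {group gT}) (a b u : gT) :
  abelian A -> H \subset A -> a \in A -> b \in A ->
  u \in <<[set a; b] :|: H>> ->
  exists i j v, v \in H /\ u = a ^+ i * b ^+ j * v.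
Proof.
move=> abA sHA Aa Ab.
have cA (B C : {group gT}) : B \subset A -> C \subset A -> C \subset 'C(B).
  by move=> sB sC; apply: subset_trans sC (subset_trans abA (centS sB)).
have [sa sb] : <[a]> \subset A /\ <[b]> \subset A by rewrite !cycle_subG.
have sab : <[a]> <*> <[b]> \subset A by rewrite join_subG sa.
have -> : <<[set a; b] :|: H>> = <[a]> * <[b]> * H.
  rewrite -[RHS]/(<[a]>%G * <[b]>%G * H) -(cent_joinEr (cA _ _ sa sb)).
  rewrite -(cent_joinEr (cA (_ <*> _)%G _ sab sHA)) /=.
  have -> : <[a]> <*> <[b]> = <<[set a; b]>> by rewrite joing_idl joing_idr.
  by rewrite joing_idl.
case/mulsgP=> _ v /mulsgP[_ _ /cycleP[i ->] /cycleP[j ->] ->] Hv ->.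
by exists i, j, v.
Qed.

(** Both sets normalise [K], so the quotient by [K] can be taken; there the generators commute, and
    centralising passes to generated subgroups. *)
Lemma commg_gen_subP (gT : finGroupType) (A B : {set gT}) (K : {group gT}) :
  A \subset 'N(K) -> B \subset 'N(K) ->
  {in A & B, forall a b, [~ a, b] \in K} -> [~: <<A>>, <<B>>] \subset K.
Proof.
move=> nA nB AB.
rewrite -quotient_cents2 ?gen_subG // !quotient_gen // cent_gen gen_subG.
by rewrite quotient_cents2r // gen_subG; apply/subsetP=> _ /imset2P[a b /AB + /[swap] ->]; apply.
Qed.

(** The candidate [K] lies between ['L_j.+2(G)] and ['L_j.+1(G)], hence is normal in [G], and
    commutators need checking on generators only. This is the induction step by which the [sigma_j]
    and [tau_j] span every layer. *)
Lemma lcnS_gen (gT : finGroupType) (G : {group gT}) (x y a b : gT) (j : nat) :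
  0 < j -> G :=: <<[set x; y]>> ->
  'L_j(G) = <<[set a; b] :|: 'L_j.+1(G)>> -> [~ a, y] = 1 -> [~ b, x] = 1 ->
  'L_j.+1(G) = <<[set [~ a, x]; [~ b, y]] :|: 'L_j.+2(G)>>.
Proof.
case: j => // j _ defG defL ay bx.
have Gx : x \in G by rewrite defG mem_gen // set21.
have Gy : y \in G by rewrite defG mem_gen // set22.
have La : a \in 'L_j.+1(G) by rewrite defL mem_gen // !inE eqxx.
have Lb : b \in 'L_j.+1(G) by rewrite defL mem_gen // !inE eqxx orbT.
set K := <<_>>.
have sKL : K \subset 'L_j.+2(G).
  rewrite gen_subG !subUset !sub1set (lcn_subS j.+2) /= andbT.
  by rewrite !mem_commg.
have nKG : G \subset 'N(K).
  rewrite -commg_subr commGC (subset_trans (commSg G sKL)) //.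
  exact: subset_trans (subsetUr _ _) (subset_gen _).
apply/eqP; rewrite eqEsubset sKL andbT.
have nLK := subset_trans (lcn_sub j.+1 G) nKG.
suff: [~: <<[set a; b] :|: 'L_j.+2(G)>>, <<[set x; y]>>] \subset K.
  by rewrite -defL -defG.
apply: commg_gen_subP => [||u v Lu v2].
- by rewrite -gen_subG -defL.
- by rewrite -gen_subG -defG.
case/setUP: Lu => [/set2P[] -> | Lu]; last first.
  apply: mem_gen; rewrite inE mem_commg ?orbT //.
  by case/set2P: v2 => ->.
all: case/set2P: v2 => ->; rewrite ?ay ?bx ?group1 //.
all: by apply: mem_gen; rewrite !inE eqxx ?orbT.
Qed.

(** The dummy generator [1] gives the two-generator shape that [gen_set2U_exp] takes apart. *)
Lemma lcn2_gen (gT : finGroupType) (G : {group gT}) (x y : gT) :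
  G :=: <<[set x; y]>> ->
  'L_2(G) = <<[set [~ y, x]; 1] :|: 'L_3(G)>>.
Proof.
move=> defG.
have Gx : x \in G by rewrite defG mem_gen // set21.
have Gy : y \in G by rewrite defG mem_gen // set22.
set K := <<_>>.
have sKL : K \subset 'L_2(G).
  by rewrite gen_subG !subUset !sub1set (lcn_subS 2) /= andbT group1 mem_commg.
have nKG : G \subset 'N(K).
  rewrite -commg_subr commGC (subset_trans (commSg G sKL)) //.
  exact: subset_trans (subsetUr _ _) (subset_gen _).
apply/eqP; rewrite eqEsubset sKL andbT.
suff: [~: <<[set x; y]>>, <<[set x; y]>>] \subset K by rewrite -defG.
apply: commg_gen_subP => [||u v].
- by rewrite -gen_subG -defG.
- by rewrite -gen_subG -defG.
have Kc : [~ y, x] \in K by apply: mem_gen; rewrite !inE eqxx.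
case/set2P=> -> /set2P[] ->; rewrite ?commgg ?group1 //.
by rewrite -invg_comm groupV.
Qed.

(** * Transfer to a normal subgroup of prime index *)

Section TransferPrimeIndex.

Variables (gT aT : finGroupType) (G H : {group gT}).
Variables (alpha : {morphism H >-> aT}) (abelA : abelian (alpha @* H)) (p : nat).
Hypotheses (nsHG : H <| G) (p_pr : prime p) (indexH : #|G : H| = p).

Lemma prime_index_mul_cycle g : g \in G :\: H -> H * <[g]> = G.
Proof.
case/setDP=> Gg nHg; have [sHG nHG] := andP nsHG.
have sgG : <[g]> \subset G by rewrite cycle_subG.
rewrite -norm_joinEr ?(subset_trans sgG) //.
have /maximal_eqP[_ /(_ (H <*> <[g]>)%G)] : maximal_eq H G.
  by rewrite /maximal_eq p_index_maximal ?indexH ?orbT.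
rewrite join_subG sHG sgG joing_subl => /(_ isT isT)[] //= eqH.
by case/negP: nHg; rewrite -eqH -cycle_subG joing_subr.
Qed.

(** As [H * <[g]> = G], [<[g]>] is transitive on the cosets of [H], and the cycle expansion of the
    transfer has a single term, of cycle length [p]. *)
Lemma transfer_prime_index_notin g :
  g \in G :\: H -> transfer G abelA g = fmod abelA (alpha (g ^+ p)).
Proof.
move=> GHg; have defG := prime_index_mul_cycle GHg.
case/setDP: GHg => Gg nHg; have [sHG nHG] := andP nsHG.
have eqB B : B \in rcosets H G :* <[g]> -> B = G.
  case/mulsgP=> _ C /rcosetsP[x Gx ->] /set1P-> ->.
  by rewrite norm_rlcoset ?(subsetP nHG) // -mulgA defG lcoset_id.
have trX : is_transversal [set 1] (rcosets H G :* <[g]>) G.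
  apply/and3P; split; first exact: rcosets_cycle_partition.
    by rewrite sub1set.
  apply/forall_inP=> B /eqB ->.
  by rewrite (setIidPl _) ?sub1set // cards1.
rewrite (transfer_cycle_expansion sHG abelA Gg trX) big_set1.
have := sum_index_rcosets_cycle sHG Gg trX; rewrite big_set1 indexH => ->.
by rewrite invg1 conjg1.
Qed.

Lemma transfer_prime_index_in g r : g \in H -> r \in G :\: H ->
  transfer G abelA g = (\sum_(i < p) fmod abelA (alpha (g ^ (r ^+ i))%g))%R.
Proof.
move=> Hg GHr; have [sHG nHG] := andP nsHG.
(* Powers of [r^-1] serve as coset representatives, so that the terms [r^-i g r^i] are the
   conjugates [g ^ (r ^+ i)]. *)
have GHr' : r^-1 \in G :\: H by rewrite !inE !groupV in GHr *.
have defG := prime_index_mul_cycle GHr'.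
have /setDP[Gr nHr] := GHr'; have Nr := subsetP nHG _ Gr.
have rp : r^-1 ^+ p \in H.
  rewrite coset_idr ?groupX // morphX // -indexH -card_quotient //.
  by rewrite expg_cardG ?mem_quotient.
pose f (i : 'I_p) := H :* r^-1 ^+ i.
have fE : [set f i | i : 'I_p] = rcosets H G.
  apply/setP=> C; apply/imsetP/rcosetsP=> [[i _ ->] | [x]].
    by exists (r^-1 ^+ i); rewrite ?groupX.
  rewrite -defG => /mulsgP[h _ Hh /cycleP[k ->] ->] ->.
  exists (Ordinal (ltn_pmod k (prime_gt0 p_pr))) => //.
  rewrite /f /=; rewrite rcosetM; rewrite rcoset_id //. rewrite {1}(divn_eq k p) expgD rcosetM.
  by rewrite mulnC expgM (rcoset_id (groupX _ rp)).
have /imset_injP f_inj : #|[set f i | i : 'I_p]| == #|'I_p|.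
  by rewrite fE card_ord -indexH.
rewrite /transfer -fE big_imset //=.
apply: eq_bigr => i _.
have -> : f i :* g = f i.
  rewrite /f -rcosetM; set x := r^-1 ^+ i.
  by rewrite conjgCV rcosetM rcoset_id // memJ_norm // groupV groupX.
(* The representative picked by [repr] differs from [r^-1 ^+ i] by some [h] in [H], which cancels in
   the abelian target. *)
rewrite /f; case: repr_rcosetP => h Hh; rewrite /restrm /=.
have Hgr : g ^ (r ^+ i) \in H by rewrite memJ_norm // groupX -?(groupV _ r).
have -> : h * r^-1 ^+ i * g * (h * r^-1 ^+ i)^-1 = h * g ^ (r ^+ i) * h^-1.
  by rewrite conjgE expgVn invMg invgK !mulgA.
move: (g ^ _) Hgr => u Hu.
have aH v : v \in H -> alpha v \in alpha @* H by move=> Hv; apply: mem_morphim.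
rewrite !morphM ?morphV ?groupM ?groupV ?aH //= zmodMgE zmodVgE.
by rewrite GRing.addrAC subrr add0r.
Qed.
End TransferPrimeIndex.

(** The commutators [[~ u, h]] already form a group, because [u -> [~ u, h]] is multiplicative on
    the abelian [A]. Since [[u,h]^h = [u^h,h]], [h] normalises it, and modulo it [h] commutes with
    [A]. *)
Lemma mem_lcn2_join_cycle (gT : finGroupType) (A : {group gT}) (h w : gT) :
  abelian A -> h \in 'N(A) ->
  w \in 'L_2(<<h |: A>>) <-> exists2 u, u \in A & w = [~ u, h].
Proof.
move=> abA nAh; set M := <<h |: A>>.
have cA := centsP abA.
have Mh : h \in M by rewrite mem_gen ?setU11.
have sAM : A \subset M by apply: subset_trans (subsetUr _ _) (subset_gen _).
split=> [|[u Au ->]]; last by rewrite mem_commg // (subsetP sAM).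
have AR u : u \in A -> [~ u, h] \in A.
  by move=> Au; rewrite groupM ?groupV // memJ_norm.
have K_group : group_set [set [~ u, h] | u in A].
  apply/group_setP; split; first by apply/imsetP; exists 1; rewrite ?comm1g.
  move=> _ _ /imsetP[u Au ->] /imsetP[v Av ->].
  apply/imsetP; exists (u * v); first exact: groupM.
  by rewrite commMgJ /conjg (cA _ (AR _ Au) _ Av) mulKg.
pose K := Group K_group.
have sKA : K \subset A by apply/subsetP=> _ /imsetP[u Au ->]; apply: AR.
have nKA : A \subset 'N(K).
  by apply: subset_trans (cent_sub _); apply: subset_trans abA (centS sKA).
have nKM : h |: A \subset 'N(K).
  rewrite subUset nKA sub1set andbT inE; apply/subsetP=> _ /imsetP[v + ->].
  case/imsetP=> u Au ->; rewrite conjRg [h ^ h]conjgE mulKg.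
  by apply/imsetP; exists (u ^ h); rewrite ?memJ_norm.
have KR u : u \in A -> [~ u, h] \in K by move=> Au; apply/imsetP; exists u.
have : 'L_2(M) \subset K.
  apply: (commg_gen_subP nKM nKM) => u v.
  case/setU1P=> [->|Au] /setU1P[->|Av]; rewrite ?commgg ?group1 ?KR //.
    by rewrite -invg_comm groupV KR.
  by rewrite (eqP (introT commgP (cA _ Au _ Av))).
by move=> /subsetP sK /sK /imsetP.
Qed.

(** * Maximal subgroups above a derived quotient of type (3,3) *)

Lemma abelian_type33 (gT : finGroupType) (A : {group gT}) :
  abelian A -> abelian_type A = [:: 3; 3] ->
  #|A| = 9 /\ {in A, forall g, g ^+ 3 = 1}.
Proof.
move=> abA tA; have [b defA ob] := abelian_structure abA; split.
  rewrite -(bigdprod_card defA) -(big_map order xpredT id) ob tA.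
  by rewrite !big_cons big_nil.
move: tA; rewrite /abelian_type -(prednK (cardG_gt0 A)) /=.
by case: ifP => //= _ [<- _] g Ag; rewrite genGid; apply: expg_exponent.
Qed.

Section Frattini33.

Variables (gT : finGroupType) (G : {group gT}).
Hypotheses (cardGq : #|G / 'L_2(G)| = 9).
Hypotheses (exp3 : {in G, forall g, g ^+ 3 \in 'L_2(G)}).

(** Modulo ['L_2(G)] one element generates a group of order dividing 3, so it never suffices for
    [G]; were [a] in ['L_2(G)], then [b] alone would suffice. *)
Lemma der_join_gen_index (a b : gT) : <<[set a; b]>> = G ->
  [/\ <<a |: 'L_2(G)>> <| G, #|G : <<a |: 'L_2(G)>>| = 3
    & b \notin <<a |: 'L_2(G)>>].
Proof.
move=> defG; set M := <<_>>.
have Ga : a \in G by rewrite -defG mem_gen // set21.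
have Gb : b \in G by rewrite -defG mem_gen // set22.
have nLG : {subset G <= 'N('L_2(G))} by apply/subsetP/lcn_norm.
have sMG : M \subset G by rewrite gen_subG subUset sub1set Ga lcn_sub.
have nsMG : M <| G.
  by rewrite sub_der1_normal // (subset_trans (subsetUr _ _) (subset_gen _)).
have ord3 g : g \in G -> #[coset 'L_2(G) g] %| 3.
  move=> Gg; rewrite order_dvdn -morphX ?nLG //=.
  by rewrite coset_id // exp3.
have defM g : g \in G -> <<g |: 'L_2(G)>> / 'L_2(G) = <[coset 'L_2(G) g]>.
  move=> Gg; rewrite -joingE -joing_idl -[<<[set g]>>]/(<[g]>).
  by rewrite quotientYidr ?quotient_cycle ?cycle_subG ?nLG.
have iM g : g \in G -> #|<<g |: 'L_2(G)>> / 'L_2(G)| %| 3.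
  by move=> Gg; rewrite defM // -orderE ord3.
have neG g : g \in G -> <<g |: 'L_2(G)>> != G.
  by move=> Gg; apply/eqP=> eqG; have := iM g Gg; rewrite eqG cardGq.
have nMb : b \notin M.
  apply: contra (neG a Ga) => Mb; rewrite eqEsubset sMG /=.
  suff: <<[set a; b]>> \subset M by rewrite defG.
  by rewrite gen_subG subUset !sub1set [b \in _]Mb mem_gen ?setU11.
split=> //; have sLM : 'L_2(G) \subset M.
  exact: subset_trans (subsetUr _ _) (subset_gen _).
have nsLM : 'L_2(G) <| M by apply: normalS sLM sMG (lcn_normal 2 G).
rewrite -divgS //= -(Lagrange sLM) -(Lagrange (lcn_sub 2 G)).
rewrite -!card_quotient ?normal_norm ?lcn_normal // cardGq.
have := iM a Ga; rewrite dvdn_divisors // !inE => /orP[] /eqP iMa.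
  have Lb : <<b |: 'L_2(G)>> == G; last by have := neG b Gb; rewrite Lb.
  have La : a \in 'L_2(G).
    have : M / 'L_2(G) == 1 by rewrite trivg_card1 iMa.
    rewrite -subG1 quotient_sub1 ?normal_norm // => /subsetP-> //.
    by rewrite mem_gen ?setU11.
  rewrite eqEsubset gen_subG subUset sub1set Gb lcn_sub /=.
  suff: <<[set a; b]>> \subset <<b |: 'L_2(G)>> by rewrite defG.
  by rewrite gen_subG subUset !sub1set !mem_gen ?setU11 // setU1r.
by rewrite -/M iMa divnMl ?cardG_gt0.
Qed.
End Frattini33.

(** * Singulets from transfer values *)

Lemma int_trit (z : int) :
  (-1 <= z <= 1)%R -> [\/ z = 0%R, z = 1%R | z = (-1)%R].
Proof.
by case: z => [[|[|z]]|[|z]] // _; [apply: Or31 | apply: Or32 | apply: Or33].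
Qed.

Section Singulet.

Variables (gT : finGroupType) (G : {group gT}) (x y : gT).
Hypotheses (defG : <<[set x; y]>> = G) (cardGq : #|G / 'L_2(G)| = 9).
Hypotheses (exp3 : {in G, forall g, g ^+ 3 \in 'L_2(G)}).

Let Gx : x \in G. Proof. by rewrite -defG mem_gen // set21. Qed.
Let Gy : y \in G. Proof. by rewrite -defG mem_gen // set22. Qed.

Lemma sub_of_mem_xy (D : {group gT}) : x \in D -> y \in D -> G \subset D.
Proof. by move=> Dx Dy; rewrite -defG gen_subG subUset !sub1set Dx. Qed.

(** Completes [max_gen x y i] to a generating pair of [G], and so serves as an element outside the
    [i]-th maximal subgroup. *)
Definition max_cogen (i : nat) : gT := nth 1 [:: x; y; x; x] i.-1.

Lemma max_gen_cogen i : 1 <= i <= 4 -> <<[set max_gen x y i; max_cogen i]>> = G.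
Proof.
move=> i14; have Gg : max_gen x y i \in G.
  by case: i i14 => [|[|[|[|[|i]]]]] //= _; rewrite /max_gen /= ?groupM ?groupV.
have Gh : max_cogen i \in G by case: i i14 {Gg} => [|[|[|[|[|i]]]]].
apply/eqP; rewrite eqEsubset gen_subG subUset !sub1set Gg Gh /=.
suff gen (D : {group gT}) :
    max_gen x y i \in D -> max_cogen i \in D -> G \subset D.
  by apply: gen; rewrite mem_gen // !inE eqxx ?orbT.
case: i i14 {Gg Gh} => [|[|[|[|[|i]]]]] //= _;
  rewrite /max_gen /max_cogen /= => Dg Dh; apply: sub_of_mem_xy => //.
  by rewrite -(mulKg x y) groupM ?groupV.
by rewrite -groupV -(mulKg x y^-1) groupM ?groupV.
Qed.

Lemma max_sub_index i : 1 <= i <= 4 ->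
  [/\ max_sub G x y i <| G, #|G : max_sub G x y i| = 3
    & max_cogen i \notin max_sub G x y i].
Proof.
by move=> i14; apply: (der_join_gen_index cardGq exp3 (max_gen_cogen i14)).
Qed.

Lemma sub_of_mem_max_gen (D : {group gT}) i j : 'L_2(G) \subset D -> 1 <= i < j -> j <= 4 ->
  max_gen x y i \in D -> max_gen x y j \in D -> G \subset D.
Proof.
move=> sLD ij j4.
have mulD u v : u \in D -> u * v \in D -> v \in D.
  by move=> Du Duv; rewrite -(mulKg u v) groupM ?groupV.
have mulDr u v : v \in D -> u * v \in D -> u \in D.
  by move=> Dv Duv; rewrite -(mulgK v u) groupM ?groupV.
have nLD g : g \in G -> g ^+ 3 \in D by move=> /exp3; apply: subsetP.
case: j ij j4 => [|[|[|[|[|j]]]]] //; case: i => [|[|[|[|i]]]] //= _ _;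
  rewrite /max_gen /= => Di Dj.
- exact: sub_of_mem_xy Dj Di.
- exact: sub_of_mem_xy (mulDr _ _ Di Dj) Di.
- exact: sub_of_mem_xy Di (mulD _ _ Di Dj).
- by apply: sub_of_mem_xy => //; apply: mulDr Dj; rewrite groupV.
- by apply: sub_of_mem_xy => //; rewrite -groupV; apply: mulD Di Dj.
(* The pair [x * y], [x * y^-1] yields [y ^+ 2]; then [y] follows because [y ^+ 3] lies in
   ['L_2(G)]. *)
have Dy2 : y ^+ 2 \in D.
  suff -> : y ^+ 2 = (x * y^-1)^-1 * (x * y) by rewrite groupM ?groupV.
  by rewrite invMg invgK -mulgA mulKg.
have Dy : y \in D by apply: (mulDr y (y ^+ 2)); rewrite -?expgS ?nLD.
exact: sub_of_mem_xy (mulDr x y Dy Di) Dy.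
Qed.

Let T i := transfer_morphism G (ab_proj_abelian (max_sub G x y i)).

Lemma ker_transferE M :
  ker_transfer G M = 'ker (transfer_morphism G (ab_proj_abelian M)) / 'L_2(G).
Proof. exact: ker_factm. Qed.

Lemma singuletP i :
  (1 <= singulet G x y i <= 4 ->
     ker_transfer G (max_sub G x y i)
       = max_sub G x y (singulet G x y i) / 'L_2(G))
  /\ (singulet G x y i = 0 ->
     ker_transfer G (max_sub G x y i) = G / 'L_2(G)).
Proof.
rewrite /singulet; case: eqP => [eqG|_]; first by split.
split=> // /andP[_ lt4]; set P := fun j => _ == _.
have hasP : has P (iota 1 4) by rewrite has_find.
by move: (nth_find 0 hasP); rewrite {1}/P nth_iota // add1n => /eqP.
Qed.

Lemma singulet_total i : T i x = 0%R -> T i y = 0%R -> singulet G x y i = 0.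
Proof.
move=> Tx Ty; rewrite /singulet ker_transferE.
have -> : 'ker (T i) = G.
  apply/eqP; rewrite eqEsubset subsetIl /=.
  by apply: sub_of_mem_xy; apply/kerP.
by rewrite eqxx.
Qed.

(** The kernel contains the maximal subgroup [M_j] and is not [G], so it is [M_j]. For [k < j] the
    generators of [M_k] and [M_j] together give [G], so the search in [singulet] passes over [k]. *)
Lemma singulet_line i j : 1 <= j <= 4 -> T i (max_gen x y j) = 0%R ->
  T i x != 0%R \/ T i y != 0%R -> singulet G x y i = j.
Proof.
move=> j14 Tj Txy; pose D := ('ker (T i))%G.
have [nsMG iM _] := max_sub_index j14.
have sLD : 'L_2(G) \subset D by have := ker_transfer_sub G (max_sub G x y i); rewrite ker_coset.
have neG : ~ G \subset D.
  move/subsetP=> sGD; case: Txy => /eqP[]; apply/mker/sGD; [exact: Gx | exact: Gy].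
have defD : D = max_sub G x y j :> {set gT}.
  have /maximal_eqP[_ /(_ D)] : maximal_eq (max_sub G x y j) G.
    by rewrite /maximal_eq p_index_maximal ?iM ?orbT ?normal_sub.
  case=> //; last by move=> eqD; case: neG; rewrite eqD.
    rewrite gen_subG subUset sLD sub1set andbT; apply/kerP => //.
    by rewrite (subsetP (normal_sub nsMG)) // mem_gen ?setU11.
  exact: subsetIl.
rewrite /singulet ker_transferE -/(T i) -/D.
have qinj (H : {group gT}) : 'L_2(G) \subset H -> H \subset G -> (D / 'L_2(G) == H / 'L_2(G)) = (D == H :> {set gT}).
  move=> sLH sHG; apply/eqP/eqP=> [|->//]; apply: quotient_inj.
    exact: normalS sLD (subsetIl _ _) (lcn_normal 2 G).
  exact: normalS sLH sHG (lcn_normal 2 G).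
rewrite qinj ?lcn_sub //; case: eqP => [eqD | _].
  by case: neG; move/eqP: eqD; rewrite eqEsubset => /andP[].
have Dj : max_gen x y j \in D by rewrite defD mem_gen ?setU11.
have neM k : 1 <= k < j -> (D / 'L_2(G) == max_sub G x y k / 'L_2(G)) = false.
  move=> kj; rewrite qinj; last 2 first.
  - exact: subset_trans (subsetUr _ _) (subset_gen _).
  - have /max_sub_index[/normal_sub //] : 1 <= k <= 4.
    by case/andP: kj => -> /ltnW /leq_trans->; case/andP: j14.
  apply/eqP=> eqD; case: neG; apply: (sub_of_mem_max_gen sLD kj _ _ Dj).
    by case/andP: j14.
  by rewrite eqD mem_gen ?setU11.
have eqj : D / 'L_2(G) == max_sub G x y j / 'L_2(G) by rewrite defD.
by case: j j14 {Tj nsMG iM defD Dj} neM eqj => [|[|[|[|[|j]]]]] //= _ neM ->;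
  rewrite ?neM.
Qed.

(** The kernel contains [y], [x], [x * y] or [x * y^-1] according as [mu = 0], [lambda = 0],
    [lambda = - mu] or [lambda = mu], which is the case split of [transfer_f]. *)
Lemma singulet_transfer i (lambda mu : int) w :
  (-1 <= lambda <= 1)%R -> (-1 <= mu <= 1)%R -> w != 0%R ->
  T i x = (w *~ lambda)%R -> T i y = (w *~ mu)%R ->
  singulet G x y i = transfer_f lambda mu.
Proof.
have Gxy : x * y \in G /\ x * y^-1 \in G by rewrite !groupM ?groupV.
move=> /int_trit lambdaP /int_trit muP nzw Tx Ty.
have Txy : T i (x * y) = (w *~ lambda + w *~ mu)%R by rewrite morphM //= Tx Ty.
have TxVy : T i (x * y^-1) = (w *~ lambda - w *~ mu)%R.
  by rewrite morphM ?groupV // morphV //= Tx Ty.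
have nzN : (- w != 0)%R by rewrite oppr_eq0.
case: lambdaP Tx Txy TxVy => -> Tx Txy TxVy; case: muP Ty Txy TxVy => ->;
  rewrite ?mulrN1z ?mulr1z ?mulr0z ?subrr ?subr0 ?addrN ?addNr ?opprK ?addr0
          ?add0r in Tx * => Ty Txy TxVy; rewrite /transfer_f /=.
all: try by apply: singulet_total.
all: apply: singulet_line => //; rewrite ?Tx ?Ty; by [left | right].
Qed.
End Singulet.

(** * The module structure of the commutator subgroup *)

Local Open Scope ring_scope.

Section IterAdditive.
Variables (V : zmodType) (Z : {additive V -> V}).

Lemma iter_raddf0 i : iter i Z 0 = 0.
Proof. by elim: i => //= i ->; rewrite raddf0. Qed.

Lemma iter_raddfD i u v : iter i Z (u + v) = iter i Z u + iter i Z v.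
Proof. by elim: i => //= i ->; rewrite raddfD. Qed.

Lemma iter_raddfMn i u n : iter i Z (u *+ n) = iter i Z u *+ n.
Proof. by elim: i => //= i ->; rewrite raddfMn. Qed.

End IterAdditive.

(** * Filtered modules: depth of elements in the image of an operator *)

Section Filtration.

Variables (V : zmodType) (L : nat -> V -> Prop).
Hypotheses (L_B : forall j u v, L j u -> L j v -> L j (u - v)).
Hypotheses (L_S : forall j u, L j.+1 u -> L j u).

Lemma filt_leq i j u : (i <= j)%N -> L j u -> L i u.
Proof. by move/subnK <-; elim: (j - i)%N => //= k IHk /L_S. Qed.

Hypothesis (L_0 : forall j, L j 0).

Lemma filtN j u : L j u -> L j (- u).
Proof. by move=> Lu; rewrite -sub0r; apply: L_B. Qed.

Lemma filtD j u v : L j u -> L j v -> L j (u + v).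
Proof. by move=> Lu /filtN Lv; rewrite -[v]opprK; apply: L_B. Qed.

Lemma filtMn j u n : L j u -> L j (u *+ n).
Proof. by move=> Lu; elim: n => // n IHn; rewrite mulrS; apply: filtD. Qed.

Lemma filtMz j u z : L j u -> L j (u *~ z).
Proof. by case: z => n Lu; [apply: filtMn | apply/filtN/filtMn]. Qed.

Lemma filt_bezout3 j u a : L j (u *+ 3) -> L j (u *+ a) -> ~ L j u ->
  exists q, a = (q * 3)%N.
Proof.
move=> Lu3 Lua nLu; exists (a %/ 3)%N.
have := divn_eq a 3; case def_r: (a %% 3)%N => [|[|[|r]]] def_a.
- by rewrite {1}def_a addn0.
- case: nLu; suff -> : u = u *+ a - u *+ 3 *+ (a %/ 3) by apply/L_B/filtMn.
  by rewrite -mulrnA {1}def_a mulrnDr mulnC addrAC subrr add0r.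
- case: nLu; suff -> : u = u *+ 3 - (u *+ a - u *+ 3 *+ (a %/ 3)).
    by apply/L_B/L_B/filtMn.
  rewrite -mulrnA {1}def_a mulrnDr mulnC [X in _ - (X - _)]addrC addrK.
  by rewrite (mulrSr _ 2) addrAC subrr add0r.
by have := ltn_pmod a (isT : 0 < 3)%N; rewrite def_r.
Qed.

Variables (Z : {additive V -> V}) (c : V) (e : nat).
Hypotheses (L_2 : forall u, L 2 u) (L_Z : forall j u, (1 < j)%N -> L j u -> L j.+1 (Z u)).
Hypothesis Z_gen : forall u, exists a w, Z u = Z c *+ a + Z (Z w).
Hypothesis Z_mul3 : forall u, exists w, Z u *+ 3 = Z (Z w).
Hypothesis Zc_notin : forall j, (2 < j < e)%N -> ~ L j.+1 (iter (j - 2) Z c).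

Lemma filt_iter i j u : (1 < j)%N -> L j u -> L (j + i) (iter i Z u).
Proof.
move=> j1 Lu; elim: i => [|i IHi]; first by rewrite addn0.
by rewrite addnS; apply: L_Z => //; rewrite (leq_trans j1) ?leq_addr.
Qed.

Lemma filt_image_depth u : (2 < e)%N -> L e (Z u) ->
  exists w, Z u = iter (e - 2) Z w.
Proof.
move=> e3 Lu.
suff depth i : (i.+2 < e)%N -> exists w, Z u = iter i.+1 Z w.
  by have -> : (e - 2 = (e - 3).+1)%N; [lia | apply: depth; lia].
elim: i => [|i IHi] ie; first by exists u.
have [|w def_u] := IHi; first by lia.
have [a [w' def_w]] := Z_gen w; have [w3 def_3] := Z_mul3 c.
have {}def_u : Z u = iter i.+1 Z c *+ a + iter i.+2 Z w'.
  by rewrite def_u !iterSr def_w iter_raddfD iter_raddfMn.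
have L_iter v : L i.+4 (iter i.+2 Z v).
  by rewrite -[i.+4]/(2 + i.+2)%N; apply: filt_iter.
have z3 : iter i.+1 Z c *+ 3 = iter i.+2 Z w3.
  by rewrite !iterSr -iter_raddfMn def_3.
(* Both [Z u] and [Z^(i+2) w'] lie in [L i.+4], hence so does [a Z^(i+1) c], while [Z^(i+1) c] does
   not. So 3 divides [a], and [z3] absorbs the term into the image of [Z^(i+2)]. *)
have [q def_a] : exists q, a = (q * 3)%N.
  apply: (@filt_bezout3 i.+4 (iter i.+1 Z c)).
  - by rewrite z3.
  - rewrite -[X in L _ X](addrK (iter i.+2 Z w')) -def_u.
    by apply: L_B; [apply: filt_leq Lu |].
  by have := @Zc_notin i.+3; rewrite subn2; apply; rewrite ie.
exists (w3 *+ q + w').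
by rewrite def_u def_a mulnC mulrnA z3 iter_raddfD iter_raddfMn.
Qed.

End Filtration.

(* The situation of the theorem inside the module 'L_2(G) with operators
   X = x - 1 and Y = y - 1: c stands for [y, x], sigma3 for y^3, tau3 for x^3
   and L j for 'L_j(G). *)
Section ModuleCore.

Variables (V : zmodType) (X Y : {additive V -> V}) (L : nat -> V -> Prop).
Variables (c sigma3 tau3 : V) (m e k : nat) (alpha beta gamma delta rho : int).

Let sigma j := iter (j - 3) X sigma3.
Let tau j := iter (j - 3) Y tau3.

Hypothesis XY : forall u, X (Y u) = Y (X u).
(* (1 + X)^3 = (1 + Y)^3 = 1, since x^3 and y^3 lie in the abelian 'L_2(G). *)
Hypotheses (X_cubed : forall u, X (X (X u)) = - (X u + X (X u)) *+ 3)
           (Y_cubed : forall u, Y (Y (Y u)) = - (Y u + Y (Y u)) *+ 3).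
Hypotheses (L_B : forall j u v, L j u -> L j v -> L j (u - v))
           (L_S : forall j u, L j.+1 u -> L j u)
           (L_0 : forall j, L j 0)
           (L_X : forall j u, (1 < j)%N -> L j u -> L j.+1 (X u))
           (L_Y : forall j u, (1 < j)%N -> L j u -> L j.+1 (Y u))
           (L_2 : forall u, L 2 u)
           (L_m : forall u, L m u -> u = 0)
           (L_proper : forall j, (1 < j < m)%N -> exists2 u, L j u & ~ L j.+1 u).
Hypotheses (L_gen2 : forall u, exists a, L 3 (u - c *+ a))
           (L_gen : forall j u, (2 < j)%N -> L j u ->
              exists a b, L j.+1 (u - (sigma j *+ a + tau j *+ b)))
           (L_noncyclic : forall j w, (2 < j <= e)%N -> L j w ->
              L j.+1 (w *+ 3) -> ~ (forall u, L j u -> exists a, L j.+1 (u - w *~ a))).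
Hypotheses (sigma_in_filt3 : L 3 sigma3) (tau_in_filt3 : L 3 tau3).
Hypotheses (Y_sigma3 : Y sigma3 = 0) (X_tau3 : X tau3 = 0).
Hypotheses (e_ge4 : (4 <= e)%N) (e_lt_m : (e + k < m)%N) (k_le1 : (k <= 1)%N).
Hypothesis L_Ye : forall u, L e u -> L (m - k) (Y u).
Hypotheses (rho1 : -1 <= rho <= 1).
Hypotheses
  (rel1 : c *+ 3 = sigma 4 + sigma (m - 1) *~ (- (rho * beta)) - tau 4)
  (rel2 : X c + sigma3 + sigma 4
     = sigma (m - 2) *~ (rho * beta) + sigma (m - 1) *~ gamma + tau e *~ delta)
  (rel3 : - Y c + tau3 + tau 4
     = sigma (m - 2) *~ (rho * delta) + sigma (m - 1) *~ alpha + tau e *~ beta)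
  (rel4 : tau e.+1 = sigma (m - 1) *~ (- rho)).

Let L_leq := filt_leq L_S.
Let L_N := filtN L_B L_0.
Let L_D := filtD L_B L_0.
Let L_Mn := filtMn L_B L_0.
Let L_Mz := filtMz L_B L_0.

Let rhoP := int_trit rho1.

(** * First consequences of the relations: multiplication by 3 *)

Lemma sigmaS j : (2 < j)%N -> sigma j.+1 = X (sigma j).
Proof. by move=> j2; rewrite /sigma subSn. Qed.

Lemma tauS j : (2 < j)%N -> tau j.+1 = Y (tau j).
Proof. by move=> j2; rewrite /tau subSn. Qed.

Lemma Y_sigma j : Y (sigma j) = 0.
Proof.
by rewrite /sigma; elim: (j - 3)%N => //= i IHi; rewrite -XY IHi raddf0.
Qed.

Lemma X_tau j : X (tau j) = 0.
Proof.
by rewrite /tau; elim: (j - 3)%N => //= i IHi; rewrite XY IHi raddf0.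
Qed.

Lemma sigma_in_filt j : (2 < j)%N -> L j (sigma j).
Proof.
elim: j => // j IHj; rewrite ltnS leq_eqVlt => /predU1P[<- // | j2].
by rewrite sigmaS //; apply: L_X; [exact: ltnW | exact: IHj].
Qed.

Lemma tau_in_filt j : (2 < j)%N -> L j (tau j).
Proof.
elim: j => // j IHj; rewrite ltnS leq_eqVlt => /predU1P[<- // | j2].
by rewrite tauS //; apply: L_Y; [exact: ltnW | exact: IHj].
Qed.

Lemma X_mul3E u : X u *+ 3 = - (X (X (X u)) + X (X u) *+ 3).
Proof. by rewrite X_cubed mulNrn mulrnDl opprD opprK addrK. Qed.

(** Since [3X = - X^3 - 3X^2], the factor 3 gains one step of the filtration beyond that of [X]. *)
Lemma L_X_mul3 j u : (1 < j)%N -> L j u -> L j.+2 (X u *+ 3).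
Proof.
move=> j1 Lu.
rewrite X_mul3E.
have L2u := L_X (leqW j1) (L_X j1 Lu).
exact/L_N/L_D/L_Mn/L2u/L_S/L_X/L2u/leqW/leqW.
Qed.

Lemma Y_mul3E u : Y u *+ 3 = - (Y (Y (Y u)) + Y (Y u) *+ 3).
Proof. by rewrite Y_cubed mulNrn mulrnDl opprD opprK addrK. Qed.

Lemma L_Y_mul3 j u : (1 < j)%N -> L j u -> L j.+2 (Y u *+ 3).
Proof.
move=> j1 Lu.
rewrite Y_mul3E.
have L2u := L_Y (leqW j1) (L_Y j1 Lu).
exact/L_N/L_D/L_Mn/L2u/L_S/L_Y/L2u/leqW/leqW.
Qed.

Lemma filt_layer_gen j : (2 < j)%N -> L j.+1 (sigma j) -> L j.+1 (tau j) ->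
  forall u, L j u -> L j.+1 u.
Proof.
move=> j2 Ls Lt u /(L_gen j2)[a [b Lu]].
by rewrite -[u](subrK (sigma j *+ a + tau j *+ b)); do !apply: L_D => //; apply: L_Mn.
Qed.

Lemma filt_layer_mul3 j u : (2 < j)%N -> L j.+1 (sigma j *+ 3) -> L j.+1 (tau j *+ 3) ->
  L j u -> L j.+1 (u *+ 3).
Proof.
move=> j2 Ls Lt /(L_gen j2)[a [b Lu]].
rewrite -[u](subrK (sigma j *+ a + tau j *+ b)) mulrnDl.
apply: L_D; first exact: L_Mn.
rewrite mulrnDl -!mulrnA ![(_ * 3)%N]mulnC !mulrnA.
by apply: L_D; apply: L_Mn.
Qed.

(** If both generators of the layer were multiples of [w], the layer would be cyclic of exponent
    dividing 3. The exponent is assumed here because [rho_eq0_or_m_gt5] must come before its general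
    proof. *)
Lemma noncyclic_of_mul3 j w a b : (2 < j <= e)%N -> L j w ->
  L j.+1 (sigma j *+ 3) -> L j.+1 (tau j *+ 3) ->
  L j.+1 (sigma j - w *~ a) -> L j.+1 (tau j - w *~ b) -> False.
Proof.
move=> /andP[j2 je] Lw Ls3 Lt3 Ls Lt.
apply: (@L_noncyclic j w); rewrite ?j2 //; first exact: filt_layer_mul3.
move=> u /(L_gen j2)[p [q Lu]]; exists (a * p%:Z + b * q%:Z).
have -> : u - w *~ (a * p%:Z + b * q%:Z)
    = (u - (sigma j *+ p + tau j *+ q)) + (sigma j - w *~ a) *+ p + (tau j - w *~ b) *+ q.
  rewrite mulrzDr !mulrzA -!pmulrn !mulrnBl -[RHS]addrA.
  by rewrite [X in _ = _ + X]addrACA [RHS]addrA subrK opprD.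
by apply: L_D; [apply: L_D => // |]; apply: L_Mn.
Qed.

(** For [m <= 5] one has [e = 4], [m = 5] and [tau 5 = 0]; then [rel4] with [rho <> 0] gives
    [sigma 4 = 0], and layer 4 would be generated by [tau 4]. *)
Lemma rho_eq0_or_m_gt5 : rho = 0 \/ (5 < m)%N.
Proof.
case: (ltnP 5 m) => [|m5]; [by right | left].
have [def_e def_m] : e = 4 /\ m = 5 by split; lia.
have t5 : tau 5 = 0 by apply: L_m; rewrite def_m; apply: tau_in_filt.
have Lt3 : L 5 (tau 4 *+ 3) by exact: (@L_Y_mul3 3 tau3).
have Ls3 : L 5 (sigma 4 *+ 3) by exact: (@L_X_mul3 3 sigma3).
case: rhoP => // def_rho; case: (@noncyclic_of_mul3 4 (tau 4) 0 1) => //.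
- exact: tau_in_filt.
- suff -> : sigma 4 = 0 by rewrite mulr0z subr0.
  by move: rel4; rewrite def_e def_m def_rho t5 mulrN1z => /eqP; rewrite eq_sym oppr_eq0 => /eqP.
- by rewrite mulr1z subrr.
- exact: tau_in_filt.
- suff -> : sigma 4 = 0 by rewrite mulr0z subr0.
  by move: rel4; rewrite def_e def_m def_rho t5 opprK mulr1z => <-.
- by rewrite mulr1z subrr.
Qed.

(** For [m >= 6] the index [m - 2] is at least 4; otherwise [rho = 0] removes that term. Hence
    modulo [L 4] the relations read [X c = - sigma3] and [Y c = tau3]. *)
Lemma L4_relations_rhs p q r :
  L 4 (sigma (m - 2) *~ (rho * p) + sigma (m - 1) *~ q + tau e *~ r).
Proof.
apply: L_D; first apply: L_D.
- case: rho_eq0_or_m_gt5 => [-> | m6]; first by rewrite mul0r mulr0z.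
  by apply/L_Mz/(@L_leq _ (m - 2)); [lia | apply: sigma_in_filt; lia].
- by apply/L_Mz/(@L_leq _ (m - 1)); [lia | apply: sigma_in_filt; lia].
by apply/L_Mz/(@L_leq _ e) => //; apply: tau_in_filt; lia.
Qed.

Lemma L4_Xc_addr_sigma3 : L 4 (X c + sigma3).
Proof.
by rewrite -[X in L 4 X](addrK (sigma 4)) rel2; apply: L_B; [apply: L4_relations_rhs | apply: sigma_in_filt].
Qed.

Lemma L4_Yc_subr_tau3 : L 4 (Y c - tau3).
Proof.
rewrite -[X in L 4 X]opprK opprB addrC; apply: L_N.
by rewrite -[X in L 4 X](addrK (tau 4)) rel3; apply: L_B; [apply: L4_relations_rhs | apply: tau_in_filt].
Qed.

Lemma sigma_in_filt_mul3 j : (2 < j)%N -> L j.+1 (sigma j *+ 3).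
Proof.
case: j => // j; rewrite ltnS leq_eqVlt => /predU1P[<- | j2].
  rewrite -[sigma 3](addKr (X c)) mulrnDl mulNrn; apply/L_D/L_Mn/L4_Xc_addr_sigma3.
  exact/L_N/L_X_mul3.
by rewrite sigmaS //; apply: L_X_mul3; [apply: ltnW | apply: sigma_in_filt].
Qed.

Lemma tau_in_filt_mul3 j : (2 < j)%N -> L j.+1 (tau j *+ 3).
Proof.
case: j => // j; rewrite ltnS leq_eqVlt => /predU1P[<- | j2].
  rewrite -[tau 3](subKr (Y c)) mulrnBl; apply/L_B/L_Mn/L4_Yc_subr_tau3.
  exact/L_Y_mul3.
by rewrite tauS //; apply: L_Y_mul3; [apply: ltnW | apply: tau_in_filt].
Qed.

Lemma noncyclic_of_mul3_mod j w a b : (2 < j <= e)%N -> L j w ->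
  L j.+1 (sigma j - w *~ a) -> L j.+1 (tau j - w *~ b) -> False.
Proof.
move=> je Lw; have /andP[j2 _] := je.
by apply: noncyclic_of_mul3 Lw (sigma_in_filt_mul3 j2) (tau_in_filt_mul3 j2).
Qed.

(** * Nontriviality and independence in the layers *)

Lemma filt_ge_m_eq0 j u : (m <= j)%N -> L j u -> u = 0.
Proof. by move=> mj Lu; apply/L_m/(L_leq mj). Qed.

Lemma filt_layer_nontrivial j : (2 < j < m)%N -> ~ (forall u, L j u -> L j.+1 u).
Proof.
move=> /andP[j2 jm] sub; have [|u Lu nLu] := @L_proper j; last exact/nLu/sub.
by rewrite jm ltnW.
Qed.

Lemma tau_notin j : (2 < j <= e)%N -> ~ L j.+1 (tau j).
Proof.
move=> je Lt; have /andP[j2 _] := je.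
apply: (@noncyclic_of_mul3_mod j (sigma j) 1 0 je (sigma_in_filt j2)); first by rewrite mulr1z subrr.
by rewrite mulr0z subr0.
Qed.

Lemma sigma_tau_indep j a : (2 < j <= e)%N -> ~ L j.+1 (sigma j - tau j *~ a).
Proof.
move=> je Ls; have /andP[j2 _] := je.
by apply: (@noncyclic_of_mul3_mod j (tau j) a 1 je (tau_in_filt j2) Ls); rewrite mulr1z subrr.
Qed.

Lemma tau_sigma_indep j a : (2 < j <= e)%N -> ~ L j.+1 (tau j - sigma j *~ a).
Proof.
move=> je Ls; have /andP[j2 _] := je.
by apply: (@noncyclic_of_mul3_mod j (sigma j) 1 a je (sigma_in_filt j2) _ Ls); rewrite mulr1z subrr.
Qed.

Lemma sigma_notin j : (2 < j < m)%N -> ~ L j.+1 (sigma j).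
Proof.
move=> jm Ls; have /andP[j2 j_lt_m] := jm.
have [je | ej] := leqP j e.
  by apply: (@sigma_tau_indep j 0); rewrite ?j2 // mulr0z subr0.
apply: (filt_layer_nontrivial jm); apply: filt_layer_gen => //.
move: ej; rewrite leq_eqVlt => /predU1P[def_j | ej].
  rewrite -def_j rel4; apply: L_Mz.
  (* If [e + 1 = m - 1], then [sigma (m - 1)] is [sigma j] itself and the assumption [Ls] applies;
     otherwise it lies deeper. *)
  have [eq_m | ne_m] := eqVneq j (m - 1)%N; first by rewrite -eq_m def_j.
  by apply: (@L_leq _ (m - 1)); [lia | apply: sigma_in_filt; lia].
have -> : tau j = 0; last exact: L_0.
have -> : tau j = iter (j - e.+2) Y (tau e.+2).
  by rewrite /tau -iterD; congr iter; lia.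
by rewrite tauS ?rel4 ?raddfMz ?Y_sigma ?mul0rz ?iter_raddf0 //; lia.
Qed.

(** * Images of [X] and [Y], and elements outside them *)

Lemma X_sigma3 : exists w, X sigma3 = X (X w).
Proof.
have [w def_w] : exists w, X (sigma (m - 2) *~ (rho * beta)) = X (X w).
  case: rho_eq0_or_m_gt5 => [-> | m6]; first by exists 0; rewrite mul0r mulr0z !raddf0.
  exists (sigma (m - 3) *~ (rho * beta)).
  by have -> : (m - 2 = (m - 3).+1)%N by [lia]; rewrite sigmaS ?raddfMz //; lia.
exists (w + sigma (m - 2) *~ gamma - sigma3 - c).
(* This is [rel2] solved for [sigma3]. Under [X] the term [tau e] dies, and every other summand goes
   into the image of [X^2]; the witness collects the preimages. *)
have def_s3 : sigma3 = sigma (m - 2) *~ (rho * beta) + sigma (m - 1) *~ gamma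
    + tau e *~ delta - sigma 4 - X c by rewrite -rel2 addrK [X c + _]addrC addrK.
have sm : sigma (m - 1) = X (sigma (m - 2)) by rewrite -sigmaS; [congr sigma|]; lia.
rewrite {1}def_s3 !(raddfB X, raddfD X) /= def_w [X (tau e *~ delta)]raddfMz X_tau.
by rewrite mul0rz addr0 sm !raddfMz.
Qed.

Lemma Y_tau3 : exists w, Y tau3 = Y (Y w).
Proof.
exists (tau (e - 1) *~ beta - tau3 + c).
have def_t3 : tau3 = sigma (m - 2) *~ (rho * delta) + sigma (m - 1) *~ alpha
    + tau e *~ beta - tau 4 + Y c.
  by rewrite -rel3 addrK [- Y c + _]addrC subrK.
have te : tau e = Y (tau (e - 1)) by rewrite -tauS; [congr tau|]; lia.
rewrite {1}def_t3 !(raddfB Y, raddfD Y) /= !raddfMz !Y_sigma !mul0rz !add0r te.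
by rewrite -!raddfMz.
Qed.

(** Downward induction on the filtration, with [i] bounding [m - j]: [X] kills [tau j], and
    [sigma j] is itself in the image of [X] for [j > 3], while [X_sigma3] settles [j = 3]. *)
Lemma X_L3_in_XX u : L 3 u -> exists w, X u = X (X w).
Proof.
suff gen i j : (2 < j)%N -> (m - j < i)%N -> forall u, L j u -> exists w, X u = X (X w).
  by apply: (gen (m - 3).+1 3).
elim: i j => // i IHi j j2 ij v Lv.
have [mj | jm] := leqP m j; first by exists 0; rewrite (filt_ge_m_eq0 mj Lv) !raddf0.
have [a [b]] := L_gen j2 Lv; set v' := v - _ => /IHi[||w def_w]; [lia | lia|].
have [w' def_w'] : exists w', X (sigma j) = X (X w').
  case: j j2 {ij Lv jm v' def_w} => // j; rewrite ltnS leq_eqVlt => /predU1P[<- | j2].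
    exact: X_sigma3.
  by exists (sigma j); rewrite sigmaS.
exists (w + w' *+ a).
have -> : v = v' + (sigma j *+ a + tau j *+ b) by rewrite subrK.
clearbody v'.
by rewrite !raddfD /= def_w !raddfMn X_tau mul0rn addr0 def_w'.
Qed.

Lemma Y_L3_in_YY u : L 3 u -> exists w, Y u = Y (Y w).
Proof.
suff gen i j : (2 < j)%N -> (m - j < i)%N -> forall u, L j u -> exists w, Y u = Y (Y w).
  by apply: (gen (m - 3).+1 3).
elim: i j => // i IHi j j2 ij v Lv.
have [mj | jm] := leqP m j; first by exists 0; rewrite (filt_ge_m_eq0 mj Lv) !raddf0.
have [a [b]] := L_gen j2 Lv; set v' := v - _ => /IHi[||w def_w]; [lia | lia|].
have [w' def_w'] : exists w', Y (tau j) = Y (Y w').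
  case: j j2 {ij Lv jm v' def_w} => // j; rewrite ltnS leq_eqVlt => /predU1P[<- | j2].
    exact: Y_tau3.
  by exists (tau j); rewrite tauS.
exists (w + w' *+ b).
have -> : v = v' + (sigma j *+ a + tau j *+ b) by rewrite subrK.
clearbody v'.
by rewrite !raddfD /= def_w !raddfMn Y_sigma mul0rn add0r def_w'.
Qed.

Lemma X_image_gen u : exists a w, X u = X c *+ a + X (X w).
Proof.
have [a /X_L3_in_XX[w def_w]] := L_gen2 u; exists a, w.
by rewrite -{1}[u](subrK (c *+ a)) raddfD def_w raddfMn addrC.
Qed.

Lemma Y_image_gen u : exists a w, Y u = Y c *+ a + Y (Y w).
Proof.
have [a /Y_L3_in_YY[w def_w]] := L_gen2 u; exists a, w.
by rewrite -{1}[u](subrK (c *+ a)) raddfD def_w raddfMn addrC.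
Qed.

Lemma X_mul3 u : exists w, X u *+ 3 = X (X w).
Proof.
exists (- (X u + u *+ 3)).
by rewrite X_mul3E !raddfN 2!raddfD !raddfMn.
Qed.

Lemma Y_mul3 u : exists w, Y u *+ 3 = Y (Y w).
Proof.
exists (- (Y u + u *+ 3)).
by rewrite Y_mul3E !raddfN 2!raddfD !raddfMn.
Qed.

(** Apply [X^(j-3)] to the congruence [X c = - sigma3] modulo [L 4]. *)
Lemma X_iter_c j : (2 < j)%N -> L j.+1 (iter (j - 2) X c + sigma j).
Proof.
move=> j2; have -> : (j - 2 = (j - 3).+1)%N by lia.
rewrite iterSr -iter_raddfD; have -> : j.+1 = (4 + (j - 3))%N by lia.
exact/(filt_iter L_X)/L4_Xc_addr_sigma3.
Qed.

Lemma Y_iter_c j : (2 < j)%N -> L j.+1 (iter (j - 2) Y c - tau j).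
Proof.
move=> j2; have -> : (j - 2 = (j - 3).+1)%N by lia.
have -> : iter (j - 3).+1 Y c - tau j = iter (j - 3) Y (Y c - tau3).
  by rewrite iterSr iter_raddfD; congr (_ + _); rewrite /tau; elim: (j - 3)%N => //= i <-; rewrite raddfN.
have -> : j.+1 = (4 + (j - 3))%N by lia.
exact/(filt_iter L_Y)/L4_Yc_subr_tau3.
Qed.

Lemma X_iter_c_notin j : (2 < j <= e)%N -> ~ L j.+1 (iter (j - 2) X c).
Proof.
move=> /andP[j2 je] Lc; apply: (@sigma_notin j); first by rewrite j2; lia.
by rewrite -[sigma j](addKr (iter (j - 2) X c)); apply: L_D; [apply: L_N | apply: X_iter_c].
Qed.

Lemma Y_iter_c_notin j : (2 < j <= e)%N -> ~ L j.+1 (iter (j - 2) Y c).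
Proof.
move=> /[dup] je /andP[j2 _] Lc; apply: (tau_notin je).
by rewrite -[tau j](subKr (iter (j - 2) Y c)); apply: L_B; [| apply: Y_iter_c].
Qed.

(** Otherwise [tau e] would be in the image of [X^(e-2)], hence modulo [L e.+1] a multiple of
    [X^(e-2) c = - sigma e], against independence in layer [e]. *)
Lemma tau_e_notin_X u : tau e <> X u.
Proof.
move=> def_t.
have Lu : L e (X u) by rewrite -def_t; apply: tau_in_filt; lia.
have [||w def_w] := filt_image_depth L_B L_S L_0 L_2 L_X X_image_gen X_mul3 _ _ Lu.
- by move=> j /andP[j2 je]; apply: X_iter_c_notin; lia.
- by lia.
have [a La] := L_gen2 w.
have Lt : L e.+1 (tau e - iter (e - 2) X c *+ a).
  rewrite def_t def_w -iter_raddfMn -[w](subrK (c *+ a)) iter_raddfD addrK.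
  have -> : e.+1 = (3 + (e - 2))%N by lia.
  exact: (filt_iter L_X).
apply: (@tau_sigma_indep e (- a%:Z)); first by lia.
rewrite mulrNz opprK -pmulrn -[tau e](subrK (iter (e - 2) X c *+ a)) -addrA -mulrnDl.
by apply: L_D => //; apply/L_Mn/X_iter_c; lia.
Qed.

Lemma sigma_notin_Y u : sigma (m - 1 - k) <> Y u.
Proof.
move=> def_s; have e2 : (2 < e)%N by lia.
have Lu : L (m - 1 - k) (Y u) by rewrite -def_s; apply: sigma_in_filt; lia.
have depth d : (2 < d <= e.+1)%N -> (d <= m - 1 - k)%N -> exists w, Y u = iter (d - 2) Y w.
  move=> /andP[d2 de] dm.
  apply: (filt_image_depth L_B L_S L_0 L_2 L_Y Y_image_gen Y_mul3) => //.
    by move=> j /andP[j2 je]; apply: Y_iter_c_notin; lia.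
  exact: L_leq Lu.
(* If [m - 1 - k > e], then [Y u] is [Y] of an element of [L e], so [L_Ye] puts it in [L (m - k)],
   which misses [sigma (m - 1 - k)]. If [m - 1 - k = e], it is a multiple of [Y^(e-2) c = tau e]
   modulo [L e.+1], against independence. *)
have [] := leqP e.+1 (m - 1 - k) => [em | em].
  have [||w def_w] := depth e.+1; [lia | lia|].
  apply: (@sigma_notin (m - 1 - k)); first by lia.
  rewrite def_s def_w subSn ?iterS; last by lia.
  have -> : (m - 1 - k).+1 = (m - k)%N by lia.
  apply: L_Ye; have -> : e = (2 + (e - 2))%N by lia.
  by rewrite addKn; apply: (filt_iter L_Y).
have {em} def_e : (m - 1 - k)%N = e by lia.
have [||w def_w] := depth e; [lia | lia|].
have [a La] := L_gen2 w.
have Lt : L e.+1 (sigma e - iter (e - 2) Y c *+ a).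
  rewrite -def_e def_s def_w -iter_raddfMn def_e -[w](subrK (c *+ a)) iter_raddfD addrK.
  have -> : e.+1 = (3 + (e - 2))%N by lia.
  exact: (filt_iter L_Y).
apply: (@sigma_tau_indep e a%:Z); first by lia.
rewrite -pmulrn -[sigma e](subrK (iter (e - 2) Y c *+ a)) -addrA -mulrnBl.
by apply: L_D => //; apply/L_Mn/Y_iter_c; lia.
Qed.

(** For [k = 0], [L_Ye] sends [tau e] into [L m = 0], so by [rel4] [rho] annihilates the nonzero
    [sigma (m - 1)]. *)
Lemma rho_eq0 : k = 0%N -> rho = 0.
Proof.
move=> k0; have t0 : tau e.+1 = 0.
  rewrite tauS; last by lia.
  by apply: L_m; have := @L_Ye (tau e); rewrite k0 subn0; apply; apply: tau_in_filt; lia.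
have ns : sigma (m - 1) <> 0.
  by move=> s0; apply: (@sigma_notin (m - 1)); [lia | rewrite s0].
case: rhoP => // def_rho; case: ns; move: rel4; rewrite t0 def_rho.
  by rewrite mulrN1z => /eqP; rewrite eq_sym oppr_eq0 => /eqP.
by rewrite opprK mulr1z.
Qed.

(** If [tau3 = D u] and [u = a c] modulo [L 3], then [tau3 = a w] modulo [L 4]. The identity in [b]
    makes [sigma3] a multiple of [w] too, so layer 3 would be cyclic. *)
Lemma tau3_notin_image (D : {additive V -> V}) w b :
  (forall u, L 3 u -> L 4 (D u)) -> L 3 w -> L 4 (D c - w) ->
  (forall a, sigma3 - w *~ (b * (a - b)) = (tau3 - w *~ a) *~ b) ->
  forall u, tau3 <> D u.
Proof.
move=> LD Lw Lc sE u def_t; have [a La] := L_gen2 u.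
have Lt : L 4 (tau3 - w *~ a%:Z).
  rewrite def_t -[u](subrK (c *+ a)) raddfD [D (c *+ a)]raddfMn -pmulrn -addrA -mulrnBl.
  by apply: L_D; [apply: LD | apply: L_Mn].
apply: (@noncyclic_of_mul3_mod 3 w (b * (a%:Z - b)) a%:Z) => //; first by lia.
by have := L_Mz b Lt; rewrite -sE.
Qed.

Lemma tau3_notin_M3 u : tau3 <> X u + Y u + Y (X u).
Proof.
(* This is [x * y - 1], expanded as [(1 + X)(1 + Y) - 1]. *)
pose D := X \+ Y \+ (Y \o X).
apply: (@tau3_notin_image D (tau3 - sigma3) 1) => [v Lv|||a].
- have LXv : L 4 (X v) by apply: L_X.
  by apply: L_D; [apply: L_D => //; apply: L_Y | apply/L_S/L_Y].
- exact: L_B.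
- rewrite /= opprB addrAC addrACA; apply: L_D; last by apply/L_Y/L_X.
  apply: L_D; [exact: L4_Xc_addr_sigma3 | exact: L4_Yc_subr_tau3].
by rewrite mul1r mulr1z mulrzBr mulr1z opprD opprK addrC -addrA subrK addrC.
Qed.

Lemma tau3_notin_M4 u : tau3 <> X u - Y u.
Proof.
(* This operator has the same image as [x * y^-1 - 1], by [actr_subMV]. *)
pose D := X \- Y.
apply: (@tau3_notin_image D (- (sigma3 + tau3)) (-1)) => [v Lv|||a].
- by apply: L_B; [apply: L_X | apply: L_Y].
- by apply/L_N/L_D.
- rewrite /= opprK addrACA [- Y c + _]addrC -[tau3 - _]opprB.
  by apply: L_B; [exact: L4_Xc_addr_sigma3 | exact: L4_Yc_subr_tau3].
rewrite opprK mulN1r mulrNz opprK mulrzDr mulr1z mulrN1z opprB addrCA.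
by congr (_ + _); rewrite opprD addrA subrr sub0r.
Qed.

(** * The relations modulo the image of an operator *)

Section Congruences.

Variables (W : zmodType) (phi : {additive V -> W}).

Lemma raddf_rel2 : phi (X c) + phi sigma3 + phi (sigma 4)
  = phi (sigma (m - 2)) *~ (rho * beta) + phi (sigma (m - 1)) *~ gamma
    + phi (tau e) *~ delta.
Proof. by rewrite -!raddfMz -!raddfD rel2. Qed.

Lemma raddf_rel3 : - phi (Y c) + phi tau3 + phi (tau 4)
  = phi (sigma (m - 2)) *~ (rho * delta) + phi (sigma (m - 1)) *~ alpha
    + phi (tau e) *~ beta.
Proof. by rewrite -!raddfMz -raddfN -!raddfD rel3. Qed.

Lemma raddf_rel1 : phi c *+ 3
  = phi (sigma 4) + phi (sigma (m - 1)) *~ (- (rho * beta)) - phi (tau 4).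
Proof. by rewrite -raddfMz -raddfD -raddfB -raddfMn rel1. Qed.

Lemma phiY_tau3 : (forall u, phi (Y u) = 0) ->
  phi tau3 = phi (sigma (m - 2)) *~ (rho * delta) + phi (sigma (m - 1)) *~ alpha.
Proof.
move=> phiY; have phi_tau j : (3 < j)%N -> phi (tau j) = 0.
  by case: j => // j j3; rewrite tauS.
by have := raddf_rel3; rewrite phiY !phi_tau // mul0rz oppr0 !addr0 add0r.
Qed.

(** The left side is the transfer of [y] to [M_1], namely [y y^x y^(x^2)] written additively. The
    [sigma 4] in [rel1] cancels the one in [rel2]. *)
Lemma phiY_sigma3 : (forall u, phi (Y u) = 0) ->
  phi sigma3 + phi c *+ 3 + phi (X c)
    = phi (sigma (m - 2)) *~ (rho * beta) + phi (sigma (m - 1)) *~ (gamma - rho * beta).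
Proof.
move=> phiY; have phi_tau j : (3 < j)%N -> phi (tau j) = 0.
  by case: j => // j j3; rewrite tauS.
have := raddf_rel2; rewrite !phi_tau // mul0rz addr0 => E.
rewrite mulrzBr [RHS]addrA -E raddf_rel1 phi_tau // subr0 mulrNz.
by rewrite [LHS]addrC !addrA.
Qed.

Lemma phi_X_sigma j : (forall u, phi (X u) = 0) -> (3 < j)%N -> phi (sigma j) = 0.
Proof. by case: j => // j phiX j3; rewrite sigmaS. Qed.

Lemma phi_rho_sigma z : (forall j, (3 < j)%N -> phi (sigma j) = 0) ->
  phi (sigma (m - 2)) *~ (rho * z) = 0.
Proof.
move=> phi_s; case: rho_eq0_or_m_gt5 => [-> | m6]; first by rewrite mul0r mulr0z.
by rewrite phi_s ?mul0rz //; lia.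
Qed.

Lemma phiX_sigma3 : (forall u, phi (X u) = 0) -> phi sigma3 = phi (tau e) *~ delta.
Proof.
move=> phiX; have phi_s := @phi_X_sigma ^~ phiX.
have := raddf_rel2; rewrite phi_rho_sigma // phiX !phi_s //; last by lia.
by rewrite mul0rz !addr0 !add0r.
Qed.

(** The left side is the transfer of [x] to [M_2]; the signs come from [[x, y] = [y, x]^-1]. Here
    the terms [tau 4] of [rel1] and [rel3] cancel. *)
Lemma phiX_tau3 : (forall u, phi (X u) = 0) ->
  phi tau3 - phi c *+ 3 - phi (Y c) = phi (tau e) *~ beta.
Proof.
move=> phiX; have phi_s := @phi_X_sigma ^~ phiX.
have := raddf_rel3; rewrite phi_rho_sigma // !phi_s //; last by lia.
rewrite mul0rz !add0r => <-; rewrite raddf_rel1 !phi_s //; last by lia.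
by rewrite mul0rz !add0r opprK [- _ + _]addrC addrAC.
Qed.

Hypothesis phi_s : forall j, (3 < j)%N -> phi (sigma j) = 0.
Hypothesis phi_t : forall j, (3 < j)%N -> phi (tau j) = 0.

Lemma phi_high_sigma3 : phi sigma3 = - phi (X c).
Proof.
have := raddf_rel2; rewrite phi_rho_sigma // !phi_s ?phi_t //; last by lia.
by rewrite !mul0rz !addr0 => /eqP; rewrite addrC addr_eq0 => /eqP.
Qed.

Lemma phi_high_tau3 : phi tau3 = phi (Y c).
Proof.
have := raddf_rel3; rewrite phi_rho_sigma // !phi_s ?phi_t //; last by lia.
by rewrite !mul0rz !addr0 addrC => /eqP; rewrite subr_eq0 => /eqP.
Qed.

End Congruences.

Lemma raddf_tau3_M3 (W : zmodType) (phi : {additive V -> W}) :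
  (forall u, phi (X u + Y u + Y (X u)) = 0) -> phi tau3 = phi sigma3.
Proof.
move=> phi0.
have phi_s j : (3 < j)%N -> phi (sigma j) = 0.
  case: j => // j j3; rewrite sigmaS //; have := phi0 (sigma j).
  by rewrite Y_sigma -XY Y_sigma !raddf0 !addr0.
have phi_t j : (3 < j)%N -> phi (tau j) = 0.
  case: j => // j j3; rewrite tauS //; have := phi0 (tau j).
  by rewrite X_tau !raddf0 add0r addr0.
rewrite phi_high_tau3 // phi_high_sigma3 //; apply/eqP; rewrite -addr_eq0 addrC.
have := phi0 c; rewrite !raddfD /=.
(* By [rel2], [X c] combines [sigma] terms, which [Y] kills, and [tau e], which [Y] sends to
   [tau e.+1], killed by [phi]. *)
have -> : phi (Y (X c)) = 0.
  have -> : X c = sigma (m - 2) *~ (rho * beta) + sigma (m - 1) *~ gamma + tau e *~ delta - sigma 4 - sigma 3.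
    by rewrite -rel2 addrK addrK.
  rewrite !(raddfB Y, raddfD Y) /= !raddfMz /= !Y_sigma !mul0rz !subr0 !add0r raddfMz.
  by rewrite -tauS ?phi_t ?mul0rz //; lia.
by rewrite addr0 => ->.
Qed.

Lemma raddf_tau3_M4 (W : zmodType) (phi : {additive V -> W}) :
  (forall u, phi (X u - Y u) = 0) -> phi tau3 = - phi sigma3.
Proof.
move=> phi0.
have phi_s j : (3 < j)%N -> phi (sigma j) = 0.
  case: j => // j j3; rewrite sigmaS //; have := phi0 (sigma j).
  by rewrite Y_sigma subr0.
have phi_t j : (3 < j)%N -> phi (tau j) = 0.
  case: j => // j j3; rewrite tauS //; have := phi0 (tau j).
  by rewrite X_tau add0r raddfN => /eqP; rewrite oppr_eq0 => /eqP.
rewrite phi_high_tau3 // phi_high_sigma3 // opprK.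
by have /eqP := phi0 c; rewrite raddfB subr_eq0 => /eqP.
Qed.

(** With [rho = 0], [rel4] stops the [tau] family at [e], so [Y] kills all generators of [L e]. For
    [k = 1] this serves to exclude [rho = 0]. *)
Lemma Y_eq0_on_filt_e : rho = 0 -> forall u, L e u -> Y u = 0.
Proof.
move=> rho0; have te : tau e.+1 = 0 by rewrite rel4 rho0 oppr0 mulr0z.
have Yt j : (e <= j)%N -> Y (tau j) = 0.
  move=> ej; have -> : tau j = iter (j - e) Y (tau e).
    by rewrite /tau -iterD; congr iter; lia.
  by rewrite -iterS iterSr -tauS ?te ?iter_raddf0 //; lia.
suff gen i j : (e <= j)%N -> (m - j < i)%N -> forall u, L j u -> Y u = 0.
  by apply: (gen (m - e).+1 e).
elim: i j => // i IHi j ej ij u Lu.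
have [mj | jm] := leqP m j; first by rewrite (filt_ge_m_eq0 mj Lu) raddf0.
have [|a [b]] := L_gen _ Lu; first by lia.
move=> /IHi Yu0; have {}Yu0 : Y (u - (sigma j *+ a + tau j *+ b)) = 0 by apply: Yu0; lia.
rewrite -[u](subrK (sigma j *+ a + tau j *+ b)) raddfD Yu0 add0r raddfD.
by rewrite [Y (sigma j *+ a)]raddfMn [Y (tau j *+ b)]raddfMn Y_sigma Yt // !mul0rn addr0.
Qed.

(** * Transfer values as multiples of one nonzero element *)

Section TransferValues.

Variables (W : zmodType) (phi : {additive V -> W}).

Lemma transfer_values1 : (k = 1%N -> rho <> 0) ->
  (forall u, phi u = 0 <-> exists w, u = Y w) ->
  exists w, [/\ w != 0, phi tau3 = w *~ (if k == 0%N then alpha else delta)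
    & phi sigma3 + phi c *+ 3 + phi (X c) = w *~ (if k == 0%N then gamma else beta)].
Proof.
move=> k1_rho phi0; have phiY u : phi (Y u) = 0 by apply/phi0; exists u.
rewrite phiY_sigma3 // phiY_tau3 //.
have nz : phi (sigma (m - 1 - k)) != 0.
  by apply/eqP=> /phi0[w /sigma_notin_Y].
move: k_le1; rewrite leq_eqVlt ltnS leqn0 orbC; case: eqP => [k0 _ | _ /= /eqP k1].
  exists (phi (sigma (m - 1))); split; first by move: nz; rewrite k0 subn0.
    by rewrite rho_eq0 // mul0r mulr0z add0r.
  by rewrite rho_eq0 // mul0r mulr0z add0r subr0.
(* For [k = 1], [phi] kills [tau e.+1 = Y (tau e)], and [rel4] with [rho] a sign passes this on to
   [sigma (m - 1)]; only [sigma (m - 2)] survives. *)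
have s0 : phi (sigma (m - 1)) = 0.
  have := congr1 phi rel4; rewrite tauS ?phiY ?raddfMz; last by lia.
  case: rhoP (k1_rho k1) => -> // _.
  by rewrite mulrN1z => /eqP; rewrite eq_sym oppr_eq0 => /eqP.
exists (phi (sigma (m - 2)) *~ rho); rewrite s0 !mul0rz !addr0 !mulrzA; split=> //.
have {}nz : phi (sigma (m - 2)) != 0 by move: nz; rewrite k1; congr (phi (sigma _) != 0); lia.
by case: rhoP (k1_rho k1) => -> // _; rewrite mulrN1z oppr_eq0.
Qed.

Lemma transfer_values2 : (forall u, phi u = 0 <-> exists w, u = X w) ->
  exists w, [/\ w != 0, phi tau3 - phi c *+ 3 - phi (Y c) = w *~ beta
    & phi sigma3 = w *~ delta].
Proof.
move=> phi0; have phiX u : phi (X u) = 0 by apply/phi0; exists u.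
exists (phi (tau e)); split; [| exact: phiX_tau3 | exact: phiX_sigma3].
by apply/eqP=> /phi0[w /tau_e_notin_X].
Qed.

Lemma transfer_values3 :
  (forall u, phi u = 0 <-> exists w, u = X w + Y w + Y (X w)) ->
  exists w, [/\ w != 0, phi tau3 = w *~ 1 & phi sigma3 = w *~ 1].
Proof.
move=> phi0; exists (phi tau3); rewrite mulr1z; split=> //.
  by apply/eqP=> /phi0[w /tau3_notin_M3].
by apply/esym/raddf_tau3_M3 => u; apply/phi0; exists u.
Qed.

Lemma transfer_values4 :
  (forall u, phi u = 0 <-> exists w, u = X w - Y w) ->
  exists w, [/\ w != 0, phi tau3 = w *~ 1 & phi sigma3 = w *~ (- 1)].
Proof.
move=> phi0; exists (phi tau3); rewrite mulr1z mulrN1z; split=> //.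
  by apply/eqP=> /phi0[w /tau3_notin_M4].
rewrite (@raddf_tau3_M4 _ phi) ?opprK // => u.
by apply/phi0; exists u.
Qed.

End TransferValues.

End ModuleCore.

Local Close Scope ring_scope.

(** * The operators [g - 1] on an abelian subgroup *)

Definition actr_sub (gT : finGroupType) (A : {group gT}) (abA : abelian A)
  (g : gT) (u : fmod_of abA) : fmod_of abA := (u ^@ g - u)%R.

Fact actr_sub_is_zmod_morphism gT A abA g : zmod_morphism (@actr_sub gT A abA g).
Proof.
move=> u v; rewrite /actr_sub actAr actNr !opprB [(v - u)%R]GRing.addrC.
by rewrite addrACA [(- _ + v)%R]GRing.addrC.
Qed.

HB.instance Definition _ gT A abA g := GRing.isZmodMorphism.Build _ _
  (@actr_sub gT A abA g) (@actr_sub_is_zmod_morphism gT A abA g).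

Section ActrSub.

Variables (gT : finGroupType) (A : {group gT}) (abA : abelian A).
Local Notation D := (actr_sub (abA := abA)).
Implicit Types (g h : gT) (u v : fmod_of abA).

Lemma fmval_actr_sub g u : g \in 'N(A) -> fmval (D g u) = [~ fmval u, g].
Proof.
by move=> Ng; rewrite /actr_sub GRing.addrC fmvalA fmvalN fmvalJ.
Qed.

Lemma actr_id g u : g \in A -> (u ^@ g = u)%R.
Proof.
move=> Ag; apply: val_inj; rewrite fmvalJ ?(subsetP (normG A)) //.
by rewrite /conjg (centsP abA _ (fmodP u) _ Ag) mulKg.
Qed.

Lemma actr_comm g h u : g \in 'N(A) -> h \in 'N(A) -> [~ g, h] \in A ->
  (u ^@ g ^@ h = u ^@ h ^@ g)%R.
Proof.
move=> Ng Nh Agh; have NAgh := subsetP (normG A) _ Agh.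
by rewrite -!actrM // (commgC g h) (actrM (groupM Nh Ng) NAgh) actr_id.
Qed.

Lemma actr_subC g h u : g \in 'N(A) -> h \in 'N(A) -> [~ g, h] \in A ->
  D g (D h u) = D h (D g u).
Proof.
move=> Ng Nh Agh; rewrite /actr_sub !actAr !actNr (actr_comm _ Ng Nh Agh).
by rewrite !opprB addrACA [RHS]addrACA; congr (_ + _)%R; apply: GRing.addrC.
Qed.

(** As [g ^+ 3] acts trivially, [T = 1 + D g] satisfies [T^3 = 1], so [(T^2 + T + 1)(T - 1) = 0]. *)
Lemma actr_sub_cubed g u : g \in 'N(A) -> g ^+ 3 \in A ->
  (D g (D g (D g u)) = - (D g u + D g (D g u)) *+ 3)%R.
Proof.
move=> Ng Ag3; have T3 : (u ^@ g ^@ g ^@ g = u)%R.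
  by rewrite -[RHS](actr_id u Ag3) !expgS expg0 mulg1 !actrM ?groupM.
have Dsum v : (D g v + v = v ^@ g)%R by rewrite /actr_sub addrNK.
set v := D g u; rewrite [(v + _)%R]GRing.addrC Dsum.
have T3v : (v ^@ g ^@ g + v = - (v ^@ g))%R.
  rewrite /v /actr_sub !(actAr, actNr) T3 opprB [LHS]GRing.addrC.
  by rewrite addrA addrNK GRing.addrC.
rewrite {1 2}/actr_sub actAr actNr opprB addrACA T3v.
by rewrite mulrS mulr2n.
Qed.

Lemma actr_subM g h u : g \in 'N(A) -> h \in 'N(A) ->
  D (g * h) u = (D g u + D h u + D h (D g u))%R.
Proof.
move=> Ng Nh; have E v : (D h v + v = v ^@ h)%R by rewrite /actr_sub addrNK.
rewrite GRing.addrAC [(D g u + _)%R]GRing.addrC E /actr_sub actrM // actAr actNr.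
by rewrite [RHS]addrA addrNK.
Qed.

(** Precomposing with the bijection [u -> u ^@ h] turns [g * h^-1 - 1] into [g - h] without changing
    its image. *)
Lemma actr_subMV g h u : g \in 'N(A) -> h \in 'N(A) -> [~ h, g] \in A ->
  D (g * h^-1) (u ^@ h)%R = (D g u - D h u)%R.
Proof.
move=> Ng Nh Ahg; rewrite /actr_sub actrM ?groupV // (actr_comm u Nh Ng Ahg) actrK.
by rewrite opprB addrA addrNK.
Qed.

Lemma fmod_expgz (a : gT) (z : int) : a \in A ->
  fmod abA (a ^z z) = (fmod abA a *~ z)%R.
Proof.
move=> Aa; case: z => n; rewrite /expgz; first by rewrite fmodX.
by rewrite fmodV fmodX.
Qed.

End ActrSub.

(** * Lower central layers and the two-step centralisers [chi] *)

Section LowerCentral.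

Variables (gT : finGroupType) (G : {group gT}).

Lemma lcn_comm_mem j u g : 0 < j -> u \in 'L_j(G) -> g \in G ->
  [~ u, g] \in 'L_j.+1(G).
Proof. by case: j => // j _ Lu Gg; apply: mem_commg. Qed.

Lemma lcn_not_sub j : nilpotent G -> 0 < j <= nil_class G ->
  ~ 'L_j(G) \subset 'L_j.+1(G).
Proof.
move=> nilG; case: j => // j /= jc sub.
have nt : 'L_j.+1(G) != 1.
  by apply: contraTneq jc => /(lcn_nil_classP j nilG); rewrite -leqNgt.
have nLG : G \subset 'N_G('L_j.+1(G)) by rewrite subsetI subxx lcn_norm.
have := nil_comm_properl nilG (lcn_sub j.+1 G) nt nLG.
by rewrite properE sub andbF.
Qed.

(** The layer lies in the cyclic group of one coset of order dividing 3. This connects cyclic layers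
    with the bound 3 in the definition of [e]. *)
Lemma lcn_quotient_card_le3 j w : w \in 'L_j(G) -> w ^+ 3 \in 'L_j.+1(G) ->
  (forall u, u \in 'L_j(G) -> exists a : int, u * (w ^z a)^-1 \in 'L_j.+1(G)) ->
  #|'L_j(G) / 'L_j.+1(G)| <= 3.
Proof.
move=> Lw Lw3 gen; set N := 'L_j.+1(G).
have nNL : {subset 'L_j(G) <= 'N(N)}.
  by apply/subsetP; apply: subset_trans (lcn_sub j G) (lcn_norm _ _).
have Nw := nNL w Lw.
suff /subset_leq_card/leq_trans : 'L_j(G) / N \subset <[coset N w]>.
  apply; rewrite -orderE dvdn_leq // order_dvdn -morphX //=.
  by rewrite coset_id.
apply/subsetP=> _ /morphimP[u Nu Lu ->]; have [a Na] := gen u Lu.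
have wN : w ^z a \in 'N(N) by case: a {Na} => n; rewrite ?groupV groupX.
rewrite /=; have -> : coset N u = coset N (w ^z a).
  by rewrite -[u](mulgKV (w ^z a)) morphM ?groupM ?groupV //= (coset_id Na) mul1g.
case: a {Na wN} => n; first by rewrite /= morphX //= mem_cycle.
by rewrite /= morphV ?groupX //= morphX //= groupV mem_cycle.
Qed.

Hypothesis abA : abelian 'L_2(G).

Lemma chi_group_set j : group_set (chi G j).
Proof.
apply/group_setP; split.
  by rewrite inE group1; apply/forall_inP=> u _; rewrite comm1g group1.
move=> g h; rewrite !inE => /andP[Gg /forall_inP chg] /andP[Gh /forall_inP chh].
rewrite groupM //; apply/forall_inP=> u Lu.
rewrite commMgJ groupM ?chh // memJ_norm ?chg //.
by apply: (subsetP (lcn_norm j.+2 G)).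
Qed.

Lemma lcn2_sub_chi j : 2 <= j -> 'L_2(G) \subset chi G j.
Proof.
move=> j2; apply/subsetP=> g Lg; rewrite inE (subsetP (lcn_sub 2 G)) //=.
apply/forall_inP=> u Lu; rewrite (eqP (introT commgP _)) ?group1 //.
exact: (centsP abA _ Lg _ (subsetP (lcn_sub_leq _ j2) _ Lu)).
Qed.

(* If y centralised 'L_e(G), then either chi_s = <y, 'L_2(G)> would centralise
   it too, or s = m - 1 and y would already lie in chi_(m-2). *)
Lemma chi_comm_not_trivial (x y : gT) (m e s : nat) :
  nilpotent G -> m = nil_index G -> 4 <= e -> e.+1 < m -> is_inv_s G s ->
  <<y |: 'L_2(G)>> <| G -> #|G : <<y |: 'L_2(G)>>| = 3 ->
  (s < m - 1 -> x \notin chi G s) -> x \in G ->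
  y \in chi G s -> y \notin 'L_2(G) ->
  [~: chi G s, 'L_e(G)] = 'L_(m - 1)(G) ->
  {in 'L_e(G), forall u, [~ u, y] = 1} -> False.
Proof.
move=> nilG def_m e4 em [/and3P[s2 sm _] s_min] nsM iM chi_x Gx chi_y nLy def_L cLy.
rewrite /nil_index /= in def_m sm.
have Gy : y \in G by case/setIdP: chi_y.
have cyL : {in 'L_e(G), forall u, [~ y, u] = 1}.
  by move=> u /cLy Lu; rewrite -invg_comm Lu invg1.
have chi_sub : chi G s \subset G by apply/subsetP=> g /setIdP[].
have ntL : 'L_(m - 1)(G) != 1.
  apply/eqP=> L1; have := @lcn_not_sub (m - 1) nilG; apply.
    by clear - def_m em; lia.
  by rewrite L1 sub1G.
have [sm1 | sm1] := ltnP s (m - 1).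
  pose K := Group (chi_group_set s).
  have sMK : <<y |: 'L_2(G)>> \subset K.
    by rewrite gen_subG subUset sub1set chi_y lcn2_sub_chi.
  have /maximal_eqP[_ /(_ K)] : maximal_eq <<y |: 'L_2(G)>> G.
    by rewrite /maximal_eq p_index_maximal ?iM ?orbT ?normal_sub.
  case=> // [defK | defK]; last first.
    by have := chi_x sm1; rewrite -[_ \in _]/(x \in K) defK Gx.
  case/eqP: ntL; rewrite -def_L -[chi G s]/(K : {set gT}) defK.
  apply/commG1P; rewrite gen_subG subUset sub1set; apply/andP; split.
    by apply/centP=> u /cyL /eqP/commgP.
  apply: subset_trans abA (centS (lcn_sub_leq _ _)).
  by rewrite (leq_trans _ e4).
have def_s : s = m - 1 by clear - def_m sm sm1; lia.
have chiG : chi G s = G.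
  apply/eqP; rewrite eqEsubset chi_sub; apply/subsetP=> g Gg; rewrite inE Gg.
  apply/forall_inP=> u Lu; rewrite -groupV invg_comm.
  have L1 : 'L_s.+1(G) = 1 by apply/(lcn_nil_classP _ nilG); clear - def_m def_s; lia.
  have : [~ u, g] \in 'L_s.+1(G) by apply: lcn_comm_mem => //; apply: ltnW.
  by rewrite L1 => /set1P->; apply: group1.
(* With [chi_s = G] the hypothesis reads ['L_e.+1(G) = 'L_(m - 1)(G)], and strict descent of the
   series forces [e + 1 = m - 1]. *)
have def_e : e = m - 2.
  have defL : 'L_e.+1(G) = 'L_(m - 1)(G).
    rewrite -def_L chiG commGC; case: (e) e4 => // ?; by [].
  have [e2 | //] : e.+1 < m - 1 \/ e = m - 2 by clear - em; lia.
  case: (@lcn_not_sub e.+1 nilG); first by clear - def_m e2; lia.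
  by rewrite defL; apply: lcn_sub_leq.
suff : s <= m - 2 by clear - def_s def_m em; lia.
apply: s_min; rewrite /nil_index; apply/and3P; split.
- by clear - em e4; lia.
- by clear - def_m; lia.
apply/properP; split; first by apply: lcn2_sub_chi; rewrite -def_e ltnW // ltnW.
exists y => //; rewrite inE Gy; apply/forall_inP=> u.
by rewrite -def_e => /cyL->; apply: group1.
Qed.

End LowerCentral.

(** * The transfer to a maximal subgroup in module terms *)

Section MaximalTransfer.

Variables (gT : finGroupType) (G : {group gT}) (abA : abelian 'L_2(G)) (h : gT).
Local Notation V := (fmod_of abA).
Local Notation M := (<<h |: 'L_2(G)>>%G).
Local Notation D := (actr_sub (abA := abA)).

(** The map called [phi] in the module part: reduction of ['L_2(G)] modulo the commutator subgroup
    of [M]. *)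
Definition ab_image (u : V) : fmod_of (ab_proj_abelian M) :=
  fmod (ab_proj_abelian M) (ab_proj M (fmval u)).

Lemma lcn2_sub_join : 'L_2(G) \subset M.
Proof. exact: subset_trans (subsetUr _ _) (subset_gen _). Qed.

Let VM (u : V) : fmval u \in M.
Proof. exact: subsetP lcn2_sub_join _ (fmodP u). Qed.

Let fproj := fun g => fmod (ab_proj_abelian M) (ab_proj M g).

Let fprojM g1 g2 : g1 \in M -> g2 \in M ->
  fproj (g1 * g2) = (fproj g1 + fproj g2)%R.
Proof.
by move=> M1 M2; rewrite /fproj morphM // fmodM // mem_morphim.
Qed.

Let fprojX g n : g \in M -> fproj (g ^+ n) = (fproj g *+ n)%R.
Proof.
by move=> Mg; rewrite /fproj morphX // fmodX // mem_morphim.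
Qed.

Fact ab_image_is_zmod_morphism : zmod_morphism ab_image.
Proof.
move=> u v; rewrite /ab_image fmvalA fmvalN.
by rewrite morphM ?groupV ?VM // morphV ?VM // fmodM ?fmodV ?groupV ?mem_morphim ?VM.
Qed.

HB.instance Definition _ := GRing.isZmodMorphism.Build _ _
  ab_image ab_image_is_zmod_morphism.

Lemma ab_image_eq0 u : h \in G -> ab_image u = 0%R <-> exists w, u = D h w.
Proof.
move=> Gh; have Nh : h \in 'N('L_2(G)) by apply: (subsetP (lcn_norm 2 G)).
have -> : ab_image u = 0%R <-> fmval u \in 'L_2(M).
  have Iu : ab_proj M (fmval u) \in ab_proj M @* M by rewrite mem_morphim ?VM.
  have nMu : fmval u \in 'N('L_2(M)) by rewrite (subsetP (lcn_norm 2 M)) ?VM.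
  split=> [u0 | Lu]; last first.
    rewrite /ab_image -[RHS](fmod1 (ab_proj_abelian M)); congr fmod.
    exact: coset_id.
  apply: coset_idr nMu _.
  by rewrite -[LHS](fmodK (ab_proj_abelian M) Iu) -/(ab_image u) u0.
rewrite mem_lcn2_join_cycle //; split=> [[w Lw def_u] | [w ->]].
  exists (fmod abA w); apply: val_inj; rewrite /= def_u.
  by rewrite -[RHS]/(fmval _) fmval_actr_sub // fmodK.
by exists (fmval w); rewrite ?fmodP ?fmval_actr_sub.
Qed.

Hypotheses (nsM : M <| G) (indexM : #|G : M| = 3).

Lemma transfer_max_notin g : g \in G :\: M -> g ^+ 3 \in 'L_2(G) ->
  transfer G (ab_proj_abelian M) g = ab_image (fmod abA (g ^+ 3)).
Proof.
move=> GMg Lg; rewrite (transfer_prime_index_notin _ nsM _ indexM) //.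
by rewrite /ab_image fmodK.
Qed.

(** The three conjugates are [g], [g d] and [g d d^r], where [d^r] is [D r d + d] additively. *)
Lemma transfer_max_in g r : g \in M -> r \in G :\: M -> g ^+ 3 \in 'L_2(G) ->
  let d := fmod abA [~ g, r] in
  transfer G (ab_proj_abelian M) g
    = (ab_image (fmod abA (g ^+ 3)) + ab_image d *+ 3 + ab_image (D r d))%R.
Proof.
move=> Mg GMr Lg d; rewrite (transfer_prime_index_in _ nsM _ indexM Mg GMr) //.
have /setDP[Gr _] := GMr; have Gg := subsetP (normal_sub nsM) _ Mg.
have val_d : fmval d = [~ g, r] by rewrite fmodK // mem_commg.
have Nr : r \in 'N('L_2(G)) by apply: (subsetP (lcn_norm 2 G)).
have gr : g ^ r = g * fmval d by rewrite val_d mulKVg.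
have grr : g ^ (r ^+ 2) = g * fmval d * fmval (D r d + d)%R.
  by rewrite /actr_sub addrNK fmvalJ // expgS expg1 conjgM gr conjMg gr.
rewrite 3!big_ord_recl big_ord0 addr0 /= conjg1 expg1 gr grr -!/(fproj _).
have fM g1 u : g1 \in M -> fproj (g1 * fmval u) = (fproj g1 + ab_image u)%R.
  by move=> Mg1; rewrite fprojM ?VM.
rewrite !fM ?groupM ?VM // raddfD /=.
have -> : ab_image (fmod abA (g ^+ 3)) = (fproj g *+ 3)%R.
  by rewrite -fprojX // /ab_image fmodK.
rewrite !mulrS mulr0n !addr0.
move: (fproj g) (ab_image d) (ab_image (D r d)) => p q r'.
by rewrite [(r' + q)%R]GRing.addrC !addrA [(p + p + q + p)%R]addrAC.
Qed.

End MaximalTransfer.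

(** * Translation into the module and evaluation of the singulets *)

Theorem theorem3p2 (gT : finGroupType) (G : {group gT}) (x y : gT)
    (m n e s k : nat) (alpha beta gamma delta rho : int) :
  3.-group G ->
  abelian 'L_2(G) ->
  abelian_type (G / 'L_2(G)) = [:: 3; 3] ->
  #|G| = (3 ^ n)%N ->
  m = nil_index G ->
  is_inv_e G e ->
  e = (n - m + 2)%N ->
  4 <= e ->
  is_inv_s G s ->
  (G : {set gT}) = <<[set x; y]>> ->
  'L_3(G) = <<[set y ^+ 3; x ^+ 3] :|: 'L_4(G)>> ->
  (s < m - 1 -> x \in G :\: chi G s) ->
  y \in chi G s :\: 'L_2(G) ->
  let sj := s_ x y in let tj := t_ x y in
  let sigma := sigma_ x y in let tau := tau_ x y in
  (-1 <= alpha <= 1)%R -> (-1 <= beta <= 1)%R -> (-1 <= gamma <= 1)%R ->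
  (-1 <= delta <= 1)%R -> (-1 <= rho <= 1)%R ->
  sj 2 ^+ 3 = sigma 4 * sigma (m - 1)%N ^z (- (rho * beta)) * (tau 4)^-1 ->
  sj 3 * sigma 3 * sigma 4
    = sigma (m - 2)%N ^z (rho * beta) * sigma (m - 1)%N ^z gamma
      * tau e ^z delta ->
  (tj 3)^-1 * tau 3 * tau 4
    = sigma (m - 2)%N ^z (rho * delta) * sigma (m - 1)%N ^z alpha
      * tau e ^z beta ->
  tau e.+1 = sigma (m - 1)%N ^z (- rho) ->
  [~: chi G s, 'L_e(G)] = 'L_(m - k)(G) ->
  k <= 1 ->
  let kappa := singulet G x y in
  [/\ kappa 1%N = (if k == 0 then transfer_f alpha gamma
                   else transfer_f delta beta),
      kappa 2 = transfer_f beta delta,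
      kappa 3 = 4
    & kappa 4 = 3]
  /\ (forall i : nat, 1 <= i <= 4 ->
        (1 <= kappa i <= 4 ->
           ker_transfer G (max_sub G x y i)
             = max_sub G x y (kappa i) / 'L_2(G))
        /\ (kappa i = 0 ->
           ker_transfer G (max_sub G x y i) = G / 'L_2(G))).
Proof.
move=> pG abA tG _ def_m e_min _ e4 s_min defG defL3 x_chi y_chi sj tj sigma tau.
move=> alpha1 beta1 gamma1 delta1 rho1 rel1 rel2 rel3 rel4 def_chi k1 kappa.
have nilG : nilpotent G := pgroup_nil pG.
have abGL : abelian (G / 'L_2(G)) by apply: sub_der1_abelian.
have [cardGL expGL] := abelian_type33 abGL tG.
have nLG : {subset G <= 'N('L_2(G))} by apply/subsetP/lcn_norm.
have exp3 : {in G, forall g, g ^+ 3 \in 'L_2(G)}.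
  move=> g Gg; apply: coset_idr; rewrite ?groupX ?nLG //.
  by rewrite morphX ?nLG //= expGL ?mem_quotient.
have Gx : x \in G by rewrite defG mem_gen // set21.
have Gy : y \in G by rewrite defG mem_gen // set22.
have [Nx Ny] := (nLG x Gx, nLG y Gy).
have defG' : <<[set x; y]>> = G by rewrite defG.
have sub_m j : j.+1 = m -> 'L_j.+1(G) = 1.
  by rewrite def_m => -[->]; apply/(lcn_nil_classP _ nilG).
pose V := fmod_of abA; pose D := actr_sub (abA := abA).
pose X : {additive V -> V} := D x; pose Y : {additive V -> V} := D y.
pose L j (u : V) : Prop := fmval u \in 'L_j(G).
pose cc := fmod abA [~ y, x]; pose s3 := fmod abA (y ^+ 3); pose t3 := fmod abA (x ^+ 3).
pose sg j := iter (j - 3) X s3; pose ta j := iter (j - 3) Y t3.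
have Ayx : [~ y, x] \in 'L_2(G) by rewrite mem_commg.
have val_X u : fmval (X u) = [~ fmval u, x] by apply: fmval_actr_sub.
have val_Y u : fmval (Y u) = [~ fmval u, y] by apply: fmval_actr_sub.
have val_sg j : fmval (sg j) = sigma j.
  by rewrite /sg /sigma /sigma_; elim: (j - 3) => [|i IHi]; rewrite ?fmodK ?exp3 //= val_X IHi.
have val_ta j : fmval (ta j) = tau j.
  by rewrite /ta /tau /tau_; elim: (j - 3) => [|i IHi]; rewrite ?fmodK ?exp3 //= val_Y IHi.
have fmod_sg j : fmod abA (sigma j) = sg j by rewrite -val_sg fmvalK.
have fmod_ta j : fmod abA (tau j) = ta j by rewrite -val_ta fmvalK.
have A_sg j : sigma j \in 'L_2(G) by rewrite -val_sg fmodP.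
have A_ta j : tau j \in 'L_2(G) by rewrite -val_ta fmodP.
have XY u : X (Y u) = Y (X u) by apply: actr_subC; rewrite // mem_commg.
have Xcubed u : X (X (X u)) = (- (X u + X (X u)) *+ 3)%R by apply: actr_sub_cubed; rewrite ?exp3.
have Ycubed u : Y (Y (Y u)) = (- (Y u + Y (Y u)) *+ 3)%R by apply: actr_sub_cubed; rewrite ?exp3.
have fvB (u v : V) : fmval (u - v)%R = fmval u * (fmval v)^-1 by [].
have fvD (u v : V) : fmval (u + v)%R = fmval u * fmval v by [].
have fvMn (u : V) n0 : fmval (u *+ n0)%R = fmval u ^+ n0 by apply: fmvalZ.
have L_B j (u v : V) : L j u -> L j v -> L j (u - v)%R.
  by move=> Lu Lv; rewrite /L fvB groupM ?groupV.
have L_S j (u : V) : L j.+1 u -> L j u by apply: (subsetP (lcn_subS j G)).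
have L_0 j : L j 0%R by rewrite /L fmval0 group1.
have L_X j (u : V) : 1 < j -> L j u -> L j.+1 (X u).
  by move=> j1 Lu; rewrite /L val_X lcn_comm_mem // ltnW.
have L_Y j (u : V) : 1 < j -> L j u -> L j.+1 (Y u).
  by move=> j1 Lu; rewrite /L val_Y lcn_comm_mem // ltnW.
have L_2 (u : V) : L 2 u by apply: fmodP.
have L_m (u : V) : L m u -> u = 0%R.
  rewrite /L def_m (sub_m (nil_class G)) -?def_m // => /set1P u1.
  exact: val_inj.
have L_proper j : 1 < j < m -> exists2 u : V, L j u & ~ L j.+1 u.
  move=> /andP[j1 jm]; have /subsetPn[u Lu nLu] : ~~ ('L_j(G) \subset 'L_j.+1(G)).
    by apply/negP/lcn_not_sub; rewrite // ltnW //= -ltnS -/(nil_index G) -def_m.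
  have Au : u \in 'L_2(G) := subsetP (lcn_sub_leq G j1) u Lu.
  by exists (fmod abA u); rewrite /L fmodK //; apply/negP.
have cancelA a b : a \in 'L_2(G) -> b \in 'L_2(G) -> a * b * a^-1 = b.
  by move=> Aa Ab; rewrite (centsP abA _ Aa _ Ab) mulgK.
have L_gen2 (u : V) : exists a, L 3 (u - cc *+ a)%R.
  have : fmval u \in <<[set [~ y, x]; 1] :|: 'L_3(G)>>.
    by rewrite -(lcn2_gen (x := x) (y := y) defG) fmodP.
  case/(gen_set2U_exp abA (lcn_subS 2 G) Ayx (group1 _)) => i [j [v [Lv def_u]]].
  exists i; rewrite /L fvB fvMn fmodK // def_u expg1n mulg1.
  by rewrite cancelA ?groupX // (subsetP (lcn_subS 2 G)).
have Ys3 : Y s3 = 0%R.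
  apply: val_inj; rewrite -[LHS]/(fmval _) val_Y fmodK ?exp3 //.
  by apply/eqP/commgP/commute_sym/commuteX.
have Xt3 : X t3 = 0%R.
  apply: val_inj; rewrite -[LHS]/(fmval _) val_X fmodK ?exp3 //.
  by apply/eqP/commgP/commute_sym/commuteX.
have sigmaS j : 2 < j -> sigma j.+1 = [~ sigma j, x].
  by move=> j2; rewrite /sigma /sigma_ subSn.
have tauS j : 2 < j -> tau j.+1 = [~ tau j, y].
  by move=> j2; rewrite /tau /tau_ subSn.
have gens j : 2 < j -> 'L_j(G) = <<[set sigma j; tau j] :|: 'L_j.+1(G)>>.
  elim: j => // j IHj; rewrite ltnS leq_eqVlt => /predU1P[<- // | j2].
  rewrite sigmaS // tauS //; apply: lcnS_gen (IHj j2) _ _ => //; first by apply: ltn_trans j2.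
    by rewrite -val_sg -val_Y [Y _](Y_sigma XY Ys3) fmval0.
  by rewrite -val_ta -val_X [X _](X_tau XY Xt3) fmval0.
have L_gen j (u : V) : 2 < j -> L j u ->
    exists a b, L j.+1 (u - (sg j *+ a + ta j *+ b))%R.
  move=> j2; rewrite /L.
  rewrite gens //.
  case/(gen_set2U_exp abA (lcn_sub_leq G (leqW (ltnW j2))) (A_sg j) (A_ta j)).
  move=> a [b [v [Lv def_u]]]; exists a, b.
  rewrite fvB fvD !fvMn val_sg val_ta def_u.
  rewrite cancelA ?groupM ?groupX //.
  by apply: subsetP Lv; apply: lcn_sub_leq; rewrite ltnW // ltnW.
have e_lt_m : e < m by rewrite def_m; case: e_min => /and3P[].
have L_noncyclic j (w : V) : 2 < j <= e -> L j w -> L j.+1 (w *+ 3)%R ->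
    ~ (forall u : V, L j u -> exists a : int, L j.+1 (u - w *~ a)%R).
  (* A cyclic layer of exponent dividing 3 has order at most 3, so minimality of [e.+1] applies. *)
  move=> /andP[j2 je] Lw Lw3 gen; suff : e.+1 <= j by rewrite ltnNge je.
  case: e_min => _; apply; apply/and4P; split=> //.
    by rewrite -def_m ltnW // (leq_ltn_trans je).
  apply: (lcn_quotient_card_le3 Lw); first by rewrite -fvMn.
  move=> u Lu; have Au : u \in 'L_2(G) := subsetP (lcn_sub_leq G (ltnW j2)) u Lu.
  have [|a] := gen (fmod abA u); first by rewrite /L fmodK.
  rewrite /L fvB fmodK // => La; exists a.
  suff -> : fmval w ^z a = fmval (w *~ a)%R by [].
  by case: a {La} => i; rewrite /expgz -fvMn.
have L_s3 : L 3 s3 by rewrite /L fmodK ?exp3 // defL3 mem_gen // !inE eqxx.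
have L_t3 : L 3 t3 by rewrite /L fmodK ?exp3 // defL3 mem_gen // !inE eqxx orbT.
have y_chi' : y \in chi G s by case/setDP: y_chi.
have chi_sub : chi G s \subset G by apply/subsetP=> g /setIdP[].
(* For [k = 1], equality [e + 1 = m] would make ['L_e(G)] equal to [[~: chi G s, 'L_e(G)]], which
   lies in the smaller ['L_e.+1(G)]. *)
have ek_lt_m : e + k < m.
  have [-> | def_k] : k = 0 \/ k = 1%N by case: (k) k1 => [|[|]]; [left | right |].
    by rewrite addn0.
  rewrite def_k addn1 ltn_neqAle e_lt_m andbT; apply/eqP=> def_e.
  case: (@lcn_not_sub _ G e nilG).
    by rewrite (leq_trans _ e4) //= -ltnS -/(nil_index G) -def_m.
  have def_e' : e = m - k by rewrite def_k -def_e subn1.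
  rewrite {1}def_e' -def_chi (subset_trans (commSg _ chi_sub)) // commGC.
  exact: lcnSnS.
have L_Ye (u : V) : L e u -> L (m - k) (Y u).
  move=> Lu; rewrite /L val_Y -def_chi -groupV invg_comm mem_commg //.
have s3E : sj 3 = fmval (X cc) by rewrite val_X fmodK.
have t3E : tj 3 = fmval (Y cc) by rewrite val_Y fmodK.
have [Xc2 Yc2] := (fmodP (X cc), fmodP (Y cc)).
have Az b z : b \in 'L_2(G) -> b ^z z \in 'L_2(G).
  by move=> Ab; case: z => i; rewrite ?groupV groupX.
have s2E : sj 2 = [~ y, x] by [].
clearbody sj tj sigma tau.
have R1 : (cc *+ 3 = sg 4 + sg (m - 1)%N *~ (- (rho * beta)) - ta 4)%R.
  rewrite -(fmodX abA 3 Ayx) -s2E rel1 fmodM ?groupM ?groupV ?Az //.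
  by rewrite fmodM ?Az // fmodV fmod_expgz // !fmod_sg fmod_ta.
have R2 : (X cc + s3 + sg 4
    = sg (m - 2)%N *~ (rho * beta) + sg (m - 1)%N *~ gamma + ta e *~ delta)%R.
  have := congr1 (fmod abA) rel2; rewrite s3E.
  rewrite (fmodM abA (groupM Xc2 (A_sg 3)) (A_sg 4)) (fmodM abA Xc2 (A_sg 3)) fmvalK.
  rewrite !fmod_sg => ->; rewrite fmodM ?groupM ?Az // fmodM ?Az //.
  by rewrite !fmod_expgz // !fmod_sg fmod_ta.
have R3 : (- Y cc + t3 + ta 4
    = sg (m - 2)%N *~ (rho * delta) + sg (m - 1)%N *~ alpha + ta e *~ beta)%R.
  have := congr1 (fmod abA) rel3; rewrite t3E.
  have Yc2' : (fmval (Y cc))^-1 \in 'L_2(G) by rewrite groupV.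
  rewrite (fmodM abA (groupM Yc2' (A_ta 3)) (A_ta 4)) (fmodM abA Yc2' (A_ta 3)).
  rewrite fmodV fmvalK !fmod_ta => ->; rewrite fmodM ?groupM ?Az // fmodM ?Az //.
  by rewrite !fmod_expgz // !fmod_sg fmod_ta.
have R4 : (ta e.+1 = sg (m - 1)%N *~ (- rho))%R.
  by rewrite -fmod_ta rel4 fmod_expgz ?fmod_sg.
have idx i (i14 : 1 <= i <= 4) := max_sub_index defG' cardGL exp3 i14.
have nLy : y \notin 'L_2(G) by case/setDP: y_chi.
(* If [rho = 0], then [Y] vanishes on ['L_e(G)], that is, [y] centralises it, which
   [chi_comm_not_trivial] rules out. *)
have k1_rho : k = 1%N -> rho <> 0%R.
  move=> def_k rho0; have [nsM iM _] := idx 1%N isT.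
  have x_chi' : s < m - 1 -> x \notin chi G s by move=> /x_chi /setDP[].
  have em : e.+1 < m by rewrite -addn1 -def_k.
  have def_chi' : [~: chi G s, 'L_e(G)] = 'L_(m - 1)(G) by rewrite def_chi def_k.
  apply: (chi_comm_not_trivial abA nilG def_m e4 em s_min nsM iM x_chi' Gx y_chi' nLy def_chi').
  move=> u Lu; have Au : u \in 'L_2(G).
    by apply: subsetP Lu; apply: lcn_sub_leq; rewrite (leq_trans _ e4).
  have := @Y_eq0_on_filt_e _ X Y L s3 t3 m e k rho XY L_S L_m L_gen Ys3 e4 ek_lt_m k1 rho1 R4 rho0 (fmod abA u).
  by rewrite /L fmodK // => /(_ Lu) Yu; rewrite -(fmodK abA Au) -val_Y Yu fmval0.
split; last by move=> i _; apply: singuletP.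
(* For [M_2] the roles of [x] and [y] are exchanged, so [[~ x, y]], which is [- cc], replaces
   [[~ y, x]]. *)
have Dc : D y (fmod abA [~ x, y]) = (- Y cc)%R.
  by rewrite -invg_comm fmodV; apply: (raddfN Y cc).
have mem_gen1 i : max_gen x y i \in max_sub G x y i by rewrite mem_gen // setU11.
split.
- have [nsM iM nx] := idx 1%N isT.
  have [w [nzw Tx Ty]] := transfer_values1 XY Xcubed Ycubed L_B L_S L_0 L_X L_Y L_2 L_m L_proper L_gen2 L_gen
    L_noncyclic L_s3 L_t3 Ys3 e4 ek_lt_m k1 L_Ye rho1 R1 R2 R3 R4
    (phi := @ab_image gT G abA y) k1_rho (fun u => ab_image_eq0 u Gy).
  rewrite /kappa (singulet_transfer defG' cardGL exp3 _ _ nzw (i := 1%N) (lambda := if k == 0%N then alpha else delta) (mu := if k == 0%N then gamma else beta)).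
  + by case: eqP.
  + by case: eqP.
  + by case: eqP.
  + rewrite -Tx; apply: (transfer_max_notin abA nsM iM); rewrite ?inE ?nx //; exact: exp3.
  rewrite -Ty; apply: (transfer_max_in abA nsM iM); rewrite ?inE ?nx //; [exact: mem_gen1 1%N | exact: exp3].
- have [nsM iM ny] := idx 2 isT.
  have [w [nzw Tx Ty]] := transfer_values2 XY Xcubed Ycubed L_B L_S L_0 L_X L_Y L_2 L_m L_proper L_gen2 L_gen
    L_noncyclic L_s3 L_t3 Ys3 Xt3 e4 ek_lt_m k1 rho1 R1 R2 R3 R4
    (phi := @ab_image gT G abA x) (fun u => ab_image_eq0 u Gx).
  rewrite /kappa (singulet_transfer defG' cardGL exp3 beta1 delta1 nzw (i := 2)) //; last first.
    rewrite -Ty; apply: (transfer_max_notin abA nsM iM); rewrite ?inE ?ny //; exact: exp3.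
  rewrite -Tx; apply: etrans (transfer_max_in abA nsM iM (mem_gen1 2) (r := y) _ _) _.
  + by rewrite inE ny.
  + exact: exp3.
  by rewrite -[max_gen x y 2]/x [actr_sub y _]Dc -invg_comm fmodV !raddfN mulNrn.
- have [nsM iM nx] := idx 3 isT.
  have ker3 (u : V) : ab_image (x * y) u = 0%R <-> exists w, u = (X w + Y w + Y (X w))%R.
    rewrite ab_image_eq0 ?groupM //.
    by split=> -[w ->]; exists w; rewrite actr_subM.
  have [w [nzw Tx Ty]] := transfer_values3 XY Xcubed Ycubed L_B L_S L_0 L_X L_Y L_2 L_m L_gen2 L_gen
    L_noncyclic L_s3 L_t3 Ys3 Xt3 e4 ek_lt_m k1 rho1 R2 R3 R4
    (phi := @ab_image gT G abA (x * y)) ker3.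
  have ny : y \notin max_sub G x y 3.
    apply: contra nx => My; rewrite -(groupMr _ My); exact: mem_gen1 3.
  rewrite /kappa (singulet_transfer defG' cardGL exp3 _ _ nzw (i := 3) (lambda := 1%R) (mu := 1%R)) //.
    rewrite -Tx; apply: (transfer_max_notin abA nsM iM); rewrite ?inE ?nx //; exact: exp3.
  rewrite -Ty; apply: (transfer_max_notin abA nsM iM); rewrite ?inE ?ny //; exact: exp3.
have [nsM iM nx] := idx 4 isT.
have ker4 (u : V) : ab_image (x * y^-1) u = 0%R <-> exists w, u = (X w - Y w)%R.
  rewrite ab_image_eq0 ?groupM ?groupV //; split=> -[w ->].
    (* The two witnesses are related by the bijection [u -> u ^@ y] of [actr_subMV]. *)
    by exists (w ^@ y^-1)%R; rewrite -actr_subMV ?mem_commg // actrKV.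
  by exists (w ^@ y)%R; rewrite actr_subMV // mem_commg.
have [w [nzw Tx Ty]] := transfer_values4 XY Xcubed Ycubed L_B L_S L_0 L_X L_Y L_2 L_m L_gen2 L_gen
  L_noncyclic L_s3 L_t3 Ys3 Xt3 e4 ek_lt_m k1 rho1 R2 R3 R4
  (phi := @ab_image gT G abA (x * y^-1)) ker4.
have ny : y \notin max_sub G x y 4.
  apply: contra nx => My; rewrite -(mulgKV y (max_cogen x y 4)) groupM //; exact: mem_gen1 4.
rewrite /kappa (singulet_transfer defG' cardGL exp3 _ _ nzw (i := 4) (lambda := 1%R) (mu := (-1)%R)) //.
  rewrite -Tx; apply: (transfer_max_notin abA nsM iM); rewrite ?inE ?nx //; exact: exp3.
rewrite -Ty; apply: (transfer_max_notin abA nsM iM); rewrite ?inE ?ny //; exact: exp3.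
Qed.
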